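(* Let $\epsilon>0$ be a constant, let $G$ be an $n$-vertex graph with maximum degree $\Delta$ and arboricity $a$, let $q\ge 2+\epsilon$, let $\hat a=q\cdot a$, and let $x\ge1$ be an integer. There is a deterministic distributed algorithm in the LOCAL model that computes a proper edge coloring of $G$ with $(\Delta^{1/x}+\hat a^{1/x}+3)^x$ colors within $O\big(\hat a^{1/x}\,(x+\tfrac{\log n}{\log q})\big)$ rounds.
   Context: LOCAL model: the input graph is the communication network; each vertex is a processor with a unique ID of $O(\log n)$ bits and unbounded local computation; computation proceeds in synchronous rounds, in each of which every vertex may send a message of arbitrary size to each neighbor; running time is the number of rounds until all vertices terminate. Global parameters ($n$, $\Delta$, $a$, $q$, $x$) are known to all vertices. The arboricity of a graph is the minimum number of forests into which its edge set can be partitioned. In an edge coloring, edges sharing an endpoint receive distinct colors, and both endpoints of an edge know its color. *)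

(* Defs.v *)
From mathcomp Require Import all_boot.
From Stdlib Require Import Reals.
Set Implicit Arguments. Unset Strict Implicit. Unset Printing Implicit Defensive.

Definition simple_graph (V : finType) (e : rel V) : Prop :=
  symmetric e /\ irreflexive e.

Definition nbrs (V : finType) (e : rel V) (v : V) : {set V} := [set u | e v u].

Definition max_degree (V : finType) (e : rel V) : nat :=
  \max_(v : V) #|nbrs e v|.

(* A decomposition of the edge set into k forests: a symmetric labelling of
   edges by labels < k such that no label class contains a cycle
   (a cycle = a duplicate-free closed walk on >= 3 vertices). *)
Definition forest_decomp (V : finType) (e : rel V) (k : nat) : Prop :=
  exists lab : V -> V -> nat,
    (forall u v, e u v -> lab u v = lab v u) /\
    (forall u v, e u v -> (lab u v < k)%N) /\
    (forall i (s : seq V), uniq s -> (2 < size s)%N ->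
        ~~ cycle (fun u v => e u v && (lab u v == i)) s).

Definition arboricity_is (V : finType) (e : rel V) (a : nat) : Prop :=
  forest_decomp e a /\ (forall k, forest_decomp e k -> (a <= k)%N).

Definition nroot (y : R) (k : nat) : R :=
  if Rle_dec y 0 then 0%R else Rpower y (/ INR k).

(* A deterministic LOCAL algorithm.  Initially a vertex knows the global
   parameters (n, Delta, a, q, x), its own ID and the (sorted) list of IDs of its
   neighbours (i.e. its incident edges).  In each synchronous round every
   non-halted vertex sends to each neighbour (identified by ID) a message of
   arbitrary type/size depending on its state, then updates its state from the
   list of (sender ID, message) pairs received.  A halted vertex keeps its state.
   The output of a vertex is, for each neighbour ID, the colour of the
   corresponding incident edge. *)
Record LocalAlg := {
  State : Type;
  Msg : Type;
  init : nat -> nat -> nat -> R -> nat -> (* n, Delta, a, q, x *)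
         nat -> seq nat -> State;        (* own ID, neighbour IDs *)
  send : State -> nat -> Msg;            (* message to neighbour with given ID *)
  recv : State -> seq (nat * Msg) -> State;
  halted : State -> bool;
  out : State -> nat -> nat              (* colour of edge to neighbour with given ID *)
}.

Section Run.
Variables (A : LocalAlg) (V : finType) (e : rel V) (ids : V -> nat)
          (n Delta a : nat) (q : R) (x : nat).

Definition nbr_ids (v : V) : seq nat :=
  sort leq [seq ids u | u <- enum (nbrs e v)].

Definition inbox (st : V -> State A) (v : V) : seq (nat * Msg A) :=
  sort (fun p1 p2 : nat * Msg A => (p1.1 <= p2.1)%N)
       [seq (ids u, send (st u) (ids v)) | u <- enum (nbrs e v)].

Fixpoint run (r : nat) : V -> State A :=
  match r with
  | 0 => fun v => init A n Delta a q x (ids v) (nbr_ids v)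
  | r'.+1 => let st := run r' in
      fun v => if halted (st v) then st v else recv (st v) (inbox st v)
  end.
End Run.

(* Edge colouring given by the outputs: col u v = colour that u assigns to edge uv.
   Proper with at most K colours (colours 0..K-1, K real bound): both endpoints agree,
   edges sharing an endpoint get distinct colours, and every colour c has c+1 <= K. *)
Definition proper_edge_coloring (V : finType) (e : rel V) (col : V -> V -> nat) (K : R) : Prop :=
  (forall u v, e u v -> col u v = col v u) /\
  (forall u v w, e u v -> e u w -> v <> w -> col u v <> col u w) /\
  (forall u v, e u v -> (INR (col u v) + 1 <= K)%R).

(* Main.v *)
(** The edges are coloured by words of length [x] over [K = rD + rA + 3] letters, where [rD] and
    [rA] are the integer [x]-th roots of [Delta] and of the out-degree [d] of an H-partition:
    vertices of degree at most [q a] among the remaining ones are peeled off layer by layer.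
    A vertex owns its edges to its own and to higher layers, and these are at most [d] many.

    The letters are chosen one after another, and the next letter must split each class of
    edges with a common prefix: at every vertex the number of owned edges in a class shrinks by
    the factor [rA + 1] and the total number by the factor [rD + 1].  For this the owned edges
    are cut into groups of [rA + 1] in which letters must differ, whereas the upper endpoint of
    an edge merely avoids the letters that it has already used too often.  Layers are treated
    from the top, and the star of edges with a given position in their groups is coloured by its
    centre, so a letter costs [O(rA)] rounds per layer; as the letters are pipelined over the
    layers, [x] is added to, not multiplied with, the number of layers.  Up to the last letter,
    edges inside a layer are split separately at their two ends and need no symmetry breaking.
    For the last letter they are split once more into directed paths, and Cole-Vishkin reduction
    on these paths gives a schedule for a greedy colouring; its [O(log log n)] rounds are
    affordable because [A (x + log n / log q)], with [A = (q a)^(1/x)], is at least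
    [sqrt (log n)].

    An algorithm gathers its view up to the final radius and then decides; that the colour of
    an edge is determined by this view is shown by comparing two arbitrary instances. *)

Require Import Defs.
From mathcomp Require Import all_boot zify.
From Stdlib Require Import Reals Lra Psatz ClassicalEpsilon.
(* [Reals] rebinds [^] on [nat] to [Nat.pow]; this restores [expn]. *)
Import ssrnat.
Set Implicit Arguments. Unset Strict Implicit. Unset Printing Implicit Defensive.

(** * Recursion along a numeric key *)

Section CausalRecursion.
Variables (E : Type) (key : E -> nat) (F : E -> (E -> nat) -> nat).
Hypothesis F_causal : forall e f g,
  (forall e', key e' < key e -> f e' = g e') -> F e f = F e g.

(** Fuel stands in for well-founded recursion; the default [0] never matters, because [F e] depends
    only on values at smaller keys. *)
Fixpoint fuelrec k e := if k is k'.+1 then F e (fuelrec k') else 0.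
Definition grec e := fuelrec (key e).+1 e.

Lemma fuelrec_stable k e : key e < k -> fuelrec k e = grec e.
Proof.
suff: forall j k k' e, key e < j -> j <= k -> j <= k' -> fuelrec k e = fuelrec k' e.
  by move=> H lt_ek; apply: (H (key e).+1).
elim=> [//|j IHj] [//|k1] [//|k2] e1 lt_e lt1 lt2 /=.
by apply: F_causal => e' lt_e'; apply: IHj; lia.
Qed.

Lemma grecE e : grec e = F e grec.
Proof. by rewrite /grec /=; apply: F_causal => e' /fuelrec_stable. Qed.

End CausalRecursion.

(** Serves greedy choices: all letters before the first admissible one are forbidden. *)
Lemma find_predC_leq_count (P : pred nat) (s : seq nat) :
  find (predC P) s <= count P s.
Proof. by elim: s => //= c s IHs; case: (P c) => //=; rewrite add1n ltnS. Qed.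

(** * Instances *)

(** Bundled, because locality compares values in two networks. The common bound [N] on identifiers
    makes keys of the form [s * N + ident] lexicographic. *)
Record instance (N : nat) := Instance {
  vtx :> finType;
  adj : rel vtx;
  ident : vtx -> nat;
  adj_sym : symmetric adj;
  adj_irr : irreflexive adj;
  ident_inj : injective ident;
  ident_lt : forall v, ident v < N }.

Definition cnt N (G : instance N) (v : G) (P : pred G) : nat :=
  \sum_(y | adj v y) P y.

Section Counting.
Variables (N : nat) (G : instance N).
Implicit Types (u v w y : G) (P Q : pred G).

Lemma cntE v P : cnt v P = #|[set y | adj v y & P y]|.
Proof.
rewrite /cnt -sum1_card big_mkcond [RHS]big_mkcond /=; apply: eq_bigr => y _.
by rewrite inE; case: (adj v y); case: (P y).
Qed.

Lemma cnt_leq v P Q : (forall y, adj v y -> P y -> Q y) -> cnt v P <= cnt v Q.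
Proof.
by move=> PQ; apply: leq_sum => y vy; case: (P y) (PQ y vy) => // ->.
Qed.

Lemma cnt_ltn v P Q u : (forall y, adj v y -> P y -> Q y) ->
  adj v u -> Q u -> ~~ P u -> cnt v P < cnt v Q.
Proof.
move=> PQ vu Qu nPu; rewrite !cntE; apply: proper_card; apply/properP; split.
  by apply/subsetP => y; rewrite !inE => /andP[vy /(PQ _ vy) ->]; rewrite vy.
by exists u; rewrite !inE ?vu ?Qu // negb_and nPu orbT.
Qed.

Lemma cnt_leqU1 v P Q u : (forall y, adj v y -> P y -> Q y || (y == u)) ->
  cnt v P <= (cnt v Q).+1.
Proof.
move=> PQ; rewrite !cntE -add1n -(cards1 u).
apply: leq_trans (leq_card_setU [set u] [set y | adj v y & Q y]).
apply: subset_leq_card; apply/subsetP => y; rewrite !inE => /andP[vy Py].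
by rewrite vy orbC; apply: PQ.
Qed.

Lemma cnt_gt0 v P y : adj v y -> P y -> 0 < cnt v P.
Proof. by move=> vy Py; rewrite cntE card_gt0; apply/set0Pn; exists y; rewrite inE vy. Qed.

Lemma cnt_inj v P (h : G -> nat) m :
  (forall y, adj v y -> P y -> h y < m) ->
  (forall y w, adj v y -> adj v w -> P y -> P w -> h y = h w -> y = w) ->
  cnt v P <= m.
Proof.
move=> lt_m h_inj; rewrite cntE.
rewrite cardE -(size_map h) -[leqRHS](size_iota 0 m); apply: uniq_leq_size.
  rewrite map_inj_in_uniq ?enum_uniq // => y w.
  by rewrite !mem_enum !inE => /andP[vy Py] /andP[vw Pw]; apply: h_inj.
move=> c /mapP[y]; rewrite mem_enum inE => /andP[vy Py] ->.
by rewrite mem_iota /= add0n lt_m.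
Qed.

Lemma cnt_split v P Q :
  cnt v P = cnt v (fun y => P y && Q y) + cnt v (fun y => P y && ~~ Q y).
Proof.
by rewrite /cnt -big_split; apply: eq_bigr => y _; case: (P y); case: (Q y).
Qed.

(** Double counting: each letter counted takes up [T] neighbours, and a neighbour carries only one
    letter. *)
Lemma count_heavy v P (f : G -> nat) T K :
  count (fun c => T <= cnt v (fun y => P y && (f y == c))) (iota 0 K) * T
    <= cnt v P.
Proof.
rewrite -sum1_count big_distrl /=.
apply: (@leq_trans (\sum_(c <- iota 0 K) cnt v (fun y => P y && (f y == c)))).
  by rewrite big_mkcond; apply: leq_sum => c _; case: ifP => //; rewrite mul1n.
rewrite /cnt exchange_big; apply: leq_sum => y _ /=.
case: (P y) => /=; last by rewrite big1.
rewrite (eq_bigr (fun c => if c == f y then 1 else 0)); last first.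
  by move=> c _; rewrite eq_sym; case: eqP.
by rewrite -big_mkcond sum1_count count_uniq_mem ?iota_uniq //; case: (_ \in _).
Qed.

End Counting.

(** * One level of the colouring *)

Section Level.
Variables (N L M K T : nat) (G : instance N) (lay : G -> nat).
Variables (cls lab gid : G -> G -> nat).
Implicit Types (u v w y : G) (f : G * G -> nat) (c : nat).

Definition own v y := lay v <= lay y.
Definition inl u v := lay u == lay v.
Definition outgoing u v := (lay u < lay v) || inl u v && (ident u < ident v).
(** Edges inside layers come first, at depth [0]; the others follow by their lower end, from the top
    layer down. Hence the edges that a vertex owns precede those reaching it from lower layers. *)
Definition depth u v := if inl u v then 0 else (L - minn (lay u) (lay v)).+1.
Definition tailid u v := if outgoing u v then ident u else ident v.
Definition slot u v := depth u v * M + (if outgoing u v then lab u v else lab v u).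
(** Within one slot only edges with a common head wait for each other, in the order of their tails;
    this keeps the cost of a slot constant. *)
Definition level_key (e : G * G) := slot e.1 e.2 * N + tailid e.1 e.2.

Definition before v y u :=
  (slot v y < slot v u)
  || [&& slot v y == slot v u, outgoing y v & ident y < ident u].

Definition tail_forbids f u v c := 0 < cnt u (fun y =>
  [&& own u y, slot u y < slot u v, cls u y == cls u v & gid u y == gid u v]
  && (f (u, y) == c)).

(** Inside a layer the head owns the edge too and keeps the letters of its group distinct; towards a
    lower layer it only refuses letters already used [T] times in the class. *)
Definition head_forbids f v u c :=
  if inl u v
  then 0 < cnt v (fun y =>
    [&& own v y, before v y u, cls v y == cls v u & gid v y == gid v u]
    && (f (v, y) == c))
  else T <= cnt v (fun y => (before v y u && (cls v y == cls v u)) && (f (v, y) == c)).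

Definition forbids f u v c := tail_forbids f u v c || head_forbids f v u c.

Definition first_free f u v := find (predC (forbids f u v)) (iota 0 K).

(** Both orders of a pair receive the letter computed from the tail; the final [0] is reached only
    when the two ends coincide. *)
Definition level_step (e : G * G) f :=
  if outgoing e.1 e.2 then first_free f e.1 e.2
  else if outgoing e.2 e.1 then first_free f e.2 e.1 else 0.

Definition level_col u v := grec level_key level_step (u, v).

Lemma inlC u v : inl u v = inl v u. Proof. exact: eq_sym. Qed.

Lemma depthC u v : depth u v = depth v u.
Proof. by rewrite /depth inlC minnC. Qed.

Lemma outNC u v : u != v -> outgoing v u = ~~ outgoing u v.
Proof.
move=> uv; have : ident u != ident v by rewrite (inj_eq (@ident_inj _ G)).
by rewrite /outgoing /inl; lia.
Qed.

Lemma outE v y : own v y -> outgoing v y = ~~ inl v y || (ident v < ident y).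
Proof. by rewrite /own /outgoing /inl; lia. Qed.

Lemma adj_neq u v : adj u v -> u != v.
Proof. by apply: contraTneq => ->; rewrite adj_irr. Qed.

Lemma tailidC u v : tailid u v = tailid v u.
Proof.
have [->//|uv] := eqVneq u v.
by rewrite /tailid (outNC uv); case: (outgoing u v).
Qed.

Lemma slotC u v : slot u v = slot v u.
Proof.
have [->//|uv] := eqVneq u v.
by rewrite /slot depthC (outNC uv); case: (outgoing u v).
Qed.

Lemma tailid_out u v : outgoing u v -> tailid u v = ident u.
Proof. by rewrite /tailid => ->. Qed.

Lemma tailid_lt u v : tailid u v < N.
Proof. by rewrite /tailid; case: ifP; rewrite ident_lt. Qed.

Lemma level_keyC u v : level_key (u, v) = level_key (v, u).
Proof. by rewrite /level_key /= slotC tailidC. Qed.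

Lemma lt_slot_key u v w y :
  slot u v < slot w y -> level_key (u, v) < level_key (w, y).
Proof.
rewrite /level_key /= => lt_s; have := tailid_lt u v; have := tailid_lt w y.
nia.
Qed.

(** For equal slots both edges point at [v], so their keys are compared by the tails. *)
Lemma before_key v y u : outgoing u v -> before v y u ->
  level_key (v, y) < level_key (v, u).
Proof.
move=> uv /orP[/lt_slot_key //|/and3P[/eqP eq_s yv lt_yu]].
by rewrite /level_key /= eq_s ltn_add2l tailidC (tailidC v) !tailid_out.
Qed.

Lemma eq_first_free f g u v : outgoing u v ->
  (forall e, level_key e < level_key (u, v) -> f e = g e) ->
  first_free f u v = first_free g u v.
Proof.
move=> uv fg; apply: eq_find => c /=; congr (~~ (_ || _)).
  rewrite /tail_forbids; congr (_ < _); apply: eq_bigr => y _.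
  case: (own u y) => //=; case: ltnP => //= lt_s.
  by rewrite fg //; apply: lt_slot_key.
rewrite /head_forbids; case: (inl u v); congr (_ <= _); apply: eq_bigr => y _.
  case: (own v y) => //=; case: (boolP (before v y u)) => //= lt_b.
  by rewrite fg // (level_keyC u); apply: before_key.
case: (boolP (before v y u)) => //= lt_b.
by rewrite fg // (level_keyC u); apply: before_key.
Qed.

Lemma level_step_causal e f g :
  (forall e', level_key e' < level_key e -> f e' = g e') ->
  level_step e f = level_step e g.
Proof.
case: e => u v fg; rewrite /level_step /=.
case: (boolP (outgoing u v)) => [o|_]; first exact: eq_first_free.
case: (boolP (outgoing v u)) => [o|//]; apply: eq_first_free => // e'.
by rewrite level_keyC; apply: fg.
Qed.

Lemma level_colE u v : level_col u v = level_step (u, v) (grec level_key level_step).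
Proof. exact/grecE/level_step_causal. Qed.

Lemma level_colC u v : level_col u v = level_col v u.
Proof.
have [->//|uv] := eqVneq u v; rewrite !level_colE /level_step /= (outNC uv).
by case: (outgoing u v).
Qed.

Lemma level_col_out u v : outgoing u v ->
  level_col u v = first_free (fun e => level_col e.1 e.2) u v.
Proof.
move=> uv; rewrite level_colE /level_step /= uv.
by apply: eq_first_free => // -[].
Qed.

Lemma depth_own_lt v y u : lay v <= L -> own v y -> ~~ own v u -> depth v y < depth v u.
Proof.
rewrite /own /depth /inl; case: eqP; case: eqP; lia.
Qed.

Lemma slot_lt_depth u v w y : (forall u v, lab u v < M) -> depth u v < depth w y -> slot u v < slot w y.
Proof.
rewrite /slot => lab_lt lt_d; set a := (X in _ + X < _); set b := (X in _ < _ + X).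
have : a < M by rewrite /a; case: ifP.
nia.
Qed.

(** * Properness and class sizes after one level *)

Section Correctness.
(** [m] bounds the groups, [T0] the classes at a vertex before this level, and [T] is the bound
    aimed at after it. *)
Variables (m T0 : nat).
Hypothesis m_gt0 : 0 < m.
Hypothesis T_gt0 : 0 < T.
Hypothesis lay_le : forall v, lay v <= L.
Hypothesis lab_lt : forall u v, lab u v < M.
Hypothesis gid_leq : forall v w, adj v w -> own v w ->
  cnt v (fun y => [&& own v y, cls v y == cls v w & gid v y == gid v w]) <= m.
Hypothesis gid_sched : forall v y w, adj v y -> adj v w -> own v y -> own v w ->
  cls v y = cls v w -> gid v y = gid v w -> slot v y = slot v w -> y != w ->
  ~~ outgoing v y /\ ~~ outgoing v w.
Hypothesis total_leq : forall v k, cnt v (fun y => cls v y == k) <= T0.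
Hypothesis palette_inl : 2 * m.-1 < K.
Hypothesis palette_cross : T0.-1 %/ T + m.-1 < K.

Notation col := level_col.
Notation colf := (fun e => level_col e.1 e.2).

Lemma count_own_forbids v w (Q : pred G) : adj v w -> own v w -> ~~ Q w ->
  count (fun c => 0 < cnt v (fun y =>
    [&& own v y, Q y, cls v y == cls v w & gid v y == gid v w]
    && (col v y == c))) (iota 0 K) <= m.-1.
Proof.
move=> vw ow nQ.
have := count_heavy v
  (fun y => [&& own v y, Q y, cls v y == cls v w & gid v y == gid v w])
  (col v) 1 K.
rewrite muln1 => /leq_trans; apply.
rewrite -ltnS prednK //; apply: leq_trans (gid_leq vw ow).
apply: (@cnt_ltn _ _ _ _ _ w) => //; last by rewrite (negPf nQ) andbF.
  by move=> y vy /and4P[-> _ -> ->].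
by rewrite ow !eqxx.
Qed.

Lemma before_irr v u : ~~ before v u u.
Proof. by rewrite /before !ltnn !andbF. Qed.

Lemma count_tail_forbids u v : adj u v -> outgoing u v ->
  count (tail_forbids colf u v) (iota 0 K) <= m.-1.
Proof.
move=> uv o; apply: (@count_own_forbids u v (fun y => slot u y < slot u v)) => //.
  by move: o; rewrite /outgoing /own /inl; lia.
by rewrite ltnn.
Qed.

Lemma count_head_forbids_inl u v : adj u v -> inl u v ->
  count (head_forbids colf v u) (iota 0 K) <= m.-1.
Proof.
move=> uv i; rewrite /head_forbids i.
apply: (@count_own_forbids v u (fun y => before v y u)) => //.
- by rewrite adj_sym.
- by move: i; rewrite /own /inl; lia.
exact: before_irr.
Qed.

Lemma count_head_forbids_cross u v : adj u v -> ~~ inl u v ->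
  count (head_forbids colf v u) (iota 0 K) <= T0.-1 %/ T.
Proof.
move=> uv i; rewrite /head_forbids (negPf i) leq_divRL //.
apply: leq_trans (count_heavy _ _ _ _ _) _.
suff: cnt v (fun y => before v y u && (cls v y == cls v u)) < T0 by lia.
apply: leq_trans (total_leq v (cls v u)).
apply: (@cnt_ltn _ _ _ _ _ u) => //=; rewrite ?(negPf (before_irr _ _)) //.
  by move=> y _ /andP[].
by rewrite adj_sym.
Qed.

(** An end that owns the edge forbids at most one letter for each of the other [m.-1] edges of the
    group. The upper end of a crossing edge sees at most [T0.-1] other edges of the class, and each
    letter it refuses takes up [T] of them. *)
Lemma count_forbids u v : adj u v -> outgoing u v ->
  count (forbids colf u v) (iota 0 K)
    <= if inl u v then 2 * m.-1 else T0.-1 %/ T + m.-1.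
Proof.
move=> uv o; have : count (forbids colf u v) (iota 0 K) <=
    count (tail_forbids colf u v) (iota 0 K)
    + count (head_forbids colf v u) (iota 0 K).
  by rewrite -count_predUI leq_addr.
have := count_tail_forbids uv o.
case: (boolP (inl u v)) => i; first by have := count_head_forbids_inl uv i; lia.
by have := count_head_forbids_cross uv i; lia.
Qed.

Lemma level_col_free u v : adj u v -> outgoing u v ->
  (col u v < K) * ~~ forbids colf u v (col u v).
Proof.
move=> uv o; rewrite (level_col_out o).
have cnt_lt : count (forbids colf u v) (iota 0 K) < K.
  by apply: leq_ltn_trans (count_forbids uv o) _; case: ifP.
have lt_K := leq_ltn_trans (find_predC_leq_count _ _) cnt_lt.
split=> //; have := @nth_find _ 0 (predC (forbids colf u v)) (iota 0 K).
by rewrite has_find size_iota => /(_ lt_K); rewrite nth_iota.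
Qed.

Lemma level_col_lt u v : adj u v -> col u v < K.
Proof.
move=> uv; case: (boolP (outgoing u v)) => o; first by rewrite level_col_free.
by rewrite level_colC level_col_free ?(outNC (adj_neq uv)) // adj_sym.
Qed.

Lemma level_col_inl u v : adj u v -> inl u v -> col u v <= 2 * m.-1.
Proof.
have H w y : adj w y -> inl w y -> outgoing w y -> col w y <= 2 * m.-1.
  move=> wy i o; rewrite (level_col_out o).
  apply: leq_trans (find_predC_leq_count _ _) _.
  by have := count_forbids wy o; rewrite i.
move=> uv i; case: (boolP (outgoing u v)) => o; first exact: H.
by rewrite level_colC; apply: H; rewrite 1?adj_sym 1?inlC // (outNC (adj_neq uv)).
Qed.

Lemma level_col_before v y w : adj v y -> adj v w -> own v y -> own v w ->
  cls v y = cls v w -> gid v y = gid v w ->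
  (if outgoing v w then slot v y < slot v w else before v y w) -> col v y != col v w.
Proof.
move=> vy vw oy ow ec eg; case: (boolP (outgoing v w)) => [o lt_s|no lt_b].
  have [_] := level_col_free vw o; rewrite negb_or => /andP[nf _].
  apply: contraNneq nf => eq_c; apply: (cnt_gt0 vy).
  by rewrite oy lt_s ec eg eq_c !eqxx.
have wv : outgoing w v by rewrite (outNC (adj_neq vw)).
have i : inl w v by move: wv ow; rewrite /outgoing /own /inl; lia.
have [_] := level_col_free (etrans (adj_sym _ _) vw) wv.
rewrite negb_or => /andP[_]; rewrite /head_forbids i; apply: contraNneq => eq_c.
by apply: (cnt_gt0 vy); rewrite oy lt_b ec eg /= eq_c level_colC !eqxx.
Qed.

(** The later edge avoids the letter of the earlier one. If the slots agree, [gid_sched] makes both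
    edges point at [v], which as their head treats them by increasing identifier of the tail. *)
Lemma level_col_proper v y w : adj v y -> adj v w -> own v y -> own v w ->
  cls v y = cls v w -> gid v y = gid v w -> y != w -> col v y != col v w.
Proof.
wlog: y w / (slot v y < slot v w) || (slot v y == slot v w) && (ident y < ident w).
  move=> H vy vw oy ow ec eg yw.
  have : ident y != ident w by rewrite (inj_eq (@ident_inj _ G)).
  case: (ltngtP (slot v y) (slot v w)) => [lt_s _|lt_s _|eq_s].
  - by apply: H => //; rewrite lt_s.
  - by rewrite eq_sym; apply: H; rewrite 1?lt_s 1?eq_sym.
  case: ltngtP => // lt_id _; first by apply: H => //; rewrite eq_s eqxx lt_id orbT.
  by rewrite eq_sym; apply: H; rewrite 1?eq_s 1?eqxx 1?lt_id 1?orbT 1?eq_sym.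
move=> lt_yw vy vw oy ow ec eg yw; apply: level_col_before => //.
case/orP: lt_yw => [lt_s|/andP[/eqP eq_s lt_id]].
  by rewrite /before lt_s /=; case: ifP.
have [ny nw] := gid_sched vy vw oy ow ec eg eq_s yw.
rewrite (negPf nw) /before eq_s eqxx ltnn /= lt_id andbT.
by rewrite (outNC (adj_neq vy)).
Qed.

(** Take the last edge [u v] from a lower layer with prefix [k] and letter [c]. The letter was not
    refused at [v], so fewer than [T] edges carried it before, and every other edge counted, owned
    or not, comes before [u v]. Without such an edge the bound on owned edges suffices. *)
Lemma level_total v k c :
  cnt v (fun y => [&& own v y, cls v y == k & col v y == c]) <= T ->
  cnt v (fun y => (cls v y == k) && (col v y == c)) <= T.
Proof.
move=> own_leT.
pose D := [pred u | [&& adj v u, ~~ own v u, cls v u == k & col v u == c]].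
have [u0 Du0|D0] := pickP D; last first.
  apply: leq_trans own_leT; apply: cnt_leq => y vy /andP[ck cc].
  by have := D0 y; rewrite /= vy ck cc !andbT /= => /negbFE ->.
have [u /and4P[vu nou /eqP uk /eqP uc] umax] :=
  @arg_maxnP _ u0 D (fun u => level_key (v, u)) Du0.
have uv : outgoing u v by move: nou; rewrite /own /outgoing; lia.
have [_] := level_col_free (etrans (adj_sym _ _) vu) uv.
rewrite negb_or => /andP[_]; rewrite /head_forbids.
have -> : inl u v = false by move: nou; rewrite /own /inl; lia.
rewrite -ltnNge => /(leq_ltn_trans _) lt_T.
apply: leq_trans (@cnt_leqU1 _ _ _ _ (fun y => (before v y u && (cls v y == cls v u))
  && (colf (v, y) == col u v)) u _) _; last first.
  by have := lt_T _ (leqnn _).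
move=> y vy /andP[/eqP yk /eqP yc]; rewrite yk uk yc level_colC uc !eqxx !andbT.
case: (boolP (own v y)) => oy.
  by rewrite /before slot_lt_depth //; apply: depth_own_lt.
have := umax y; rewrite /= vy oy yk yc !eqxx /= => /(_ isT).
have yv : outgoing y v by move: oy; rewrite /own /outgoing; lia.
rewrite /level_key /= /before yv !(tailidC v) !tailid_out //=.
have := ident_lt y; have := ident_lt u.
have [->|/eqP yu] := eqVneq y u; first by rewrite orbT.
have : ident y != ident u by rewrite (inj_eq (@ident_inj _ G)); apply/eqP.
rewrite orbF; nia.
Qed.

End Correctness.
End Level.

(** * Locality *)

(** A view is what a vertex has accumulated when everybody forwards all it knows; the neighbours are
    sorted as in [inbox], so that views are literally states of a run. *)
Inductive view : Type :=
  | VLeaf of nat & seq nat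
  | VNode of view & seq (nat * view).

Fixpoint view_at N (G : instance N) (t : nat) (v : G) : view :=
  if t is t'.+1
  then VNode (view_at t' v)
    (sort (fun p1 p2 : nat * view => p1.1 <= p2.1)
       [seq (ident u, view_at t' u) | u <- enum (nbrs (@adj N G) v)])
  else VLeaf (ident v) (nbr_ids (@adj N G) (@ident N G) v).

Definition sim N t (G G' : instance N) (v : G) (v' : G') := view_at t v = view_at t v'.

Section Similarity.
Variable N : nat.
Implicit Types G : instance N.

Lemma sim_leq s t G G' (v : G) (v' : G') : s <= t -> sim t v v' -> sim s v v'.
Proof.
elim: t => [|t IHt]; first by rewrite leqn0 => /eqP->.
by rewrite leq_eqVlt ltnS => /predU1P[-> //|/IHt H] [/H].
Qed.

Lemma sim_ident t G G' (v : G) (v' : G') : sim t v v' -> ident v = ident v'.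
Proof. by move/(sim_leq (leq0n t)) => []. Qed.

Lemma sim_nbr_map t G G' (v : G) (v' : G') : sim t.+1 v v' ->
  exists s s', [/\ perm_eq s (enum (nbrs (@adj N G) v)),
    perm_eq s' (enum (nbrs (@adj N G') v')) &
    [seq (ident u, view_at t u) | u <- s] = [seq (ident u, view_at t u) | u <- s']].
Proof.
move=> [_]; rewrite !sort_map => eq_map.
by eexists _, _; split; [| | exact: eq_map]; rewrite perm_sort.
Qed.

Lemma sim_nbr t G G' (v : G) (v' : G') u : sim t.+1 v v' -> adj v u ->
  exists2 u', adj v' u' & sim t u u'.
Proof.
move=> /sim_nbr_map[s [s' [ps ps' eq_ss']]] vu.
have us : u \in s by rewrite (perm_mem ps) mem_enum inE.
have sz : size s = size s' by move/(congr1 size): eq_ss'; rewrite !size_map.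
have lt_i : index u s < size s by rewrite index_mem.
case: s' => [|u0 s'] in ps' eq_ss' sz *; first by rewrite sz in lt_i.
exists (nth u0 (u0 :: s') (index u s)).
  have : nth u0 (u0 :: s') (index u s) \in u0 :: s' by rewrite mem_nth -?sz.
  by rewrite (perm_mem ps') mem_enum inE.
have := congr1 (fun l => nth (ident u, view_at t u) l (index u s)) eq_ss'.
by rewrite (nth_map u) // (nth_map u0) -?sz // nth_index // => -[_].
Qed.

(** Some neighbour of [v'] has the view of [u]; by injectivity of identifiers it is [u']. *)
Lemma sim_nbr_ident t G G' (v u : G) (v' u' : G') : sim t.+1 v v' ->
  adj v u -> adj v' u' -> ident u = ident u' -> sim t u u'.
Proof.
move=> svv vu vu' eq_id; have [w' vw' suw] := sim_nbr svv vu.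
suff -> : u' = w' by [].
by apply: (@ident_inj _ G'); rewrite -eq_id (sim_ident suw).
Qed.

(** Equal sorted lists of neighbour views match the neighbourhoods term by term. All quantities of
    the colouring are read off such sums. *)
Lemma sum_sim t G G' (v : G) (v' : G') (g : G -> nat) (g' : G' -> nat) :
  sim t.+1 v v' ->
  (forall y y', adj v y -> adj v' y' -> sim t y y' -> g y = g' y') ->
  \sum_(y | adj v y) g y = \sum_(y | adj v' y) g' y.
Proof.
move=> /sim_nbr_map[s [s' [ps ps' eq_ss']]] gg'.
have sumE (H : instance N) (w : H) (h : H -> nat) l :
    perm_eq l (enum (nbrs (@adj N H) w)) ->
    \sum_(y | adj w y) h y = \sum_(y <- l) h y.
  move=> pl; rewrite (perm_big _ pl) /= big_enum.
  by apply: eq_bigl => y; rewrite inE.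
rewrite (sumE _ _ _ _ ps) (sumE _ _ _ _ ps').
have : {in s & s', forall y y', sim t y y' -> g y = g' y'}.
  move=> y y'; rewrite (perm_mem ps) (perm_mem ps') !mem_enum !inE.
  exact: gg'.
elim: s s' eq_ss' {ps ps'} => [|y s IHs] [|y' s'] //=.
  by rewrite !big_nil.
move=> [_ eq_y eq_s] H.
rewrite !big_cons (H y y') ?inE ?eqxx // (IHs s') // => z z' zs zs'.
by apply: H; rewrite inE ?zs ?zs' orbT.
Qed.

Lemma cnt_sim t G G' (v : G) (v' : G') (P : pred G) (P' : pred G') :
  sim t.+1 v v' ->
  (forall y y', adj v y -> adj v' y' -> sim t y y' -> P y = P' y') ->
  cnt v P = cnt v' P'.
Proof.
by move=> svv PP'; apply: sum_sim svv _ => y y' vy vy' /PP' ->.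
Qed.

End Similarity.

Section DepthLocality.
Variables (N L : nat) (lay : forall G : instance N, G -> nat).
Implicit Types G : instance N.

Definition vlocal t (X : forall G : instance N, G -> nat) :=
  forall G G' (v : G) (v' : G'), sim t v v' -> X G v = X G' v'.

(* The radius of an edge grows by [B] with its depth: since a level of the colouring
   at depth [i] only needs the previous level at depths up to [i], the levels are
   pipelined and their number adds to, rather than multiplies, the number of layers. *)
Definition elocal r B (X : forall G : instance N, G -> G -> nat) :=
  forall G G' (u v : G) (u' v' : G'), adj u v -> adj u' v' ->
    sim (r + B * depth L (@lay G) u v) u u' ->
    sim (r + B * depth L (@lay G) u v) v v' -> X G u v = X G' u' v'.

Lemma elocal_leq r s B X : r <= s -> elocal r B X -> elocal s B X.
Proof.
move=> le_rs H G G' u v u' v' uv uv' su sv.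
by apply: H => //; [apply: sim_leq su | apply: sim_leq sv]; rewrite leq_add2r.
Qed.

Section WithLay.
Variable r : nat.
Hypothesis lay_local : vlocal r lay.

Section Pair.
Variables (G G' : instance N) (u v : G) (u' v' : G').
Hypotheses (su : sim r u u') (sv : sim r v v').

Let eq_lay : (lay u = lay u') * (lay v = lay v').
Proof. by split; apply: lay_local. Qed.

Lemma inl_sim : inl (@lay G) u v = inl (@lay G') u' v'.
Proof. by rewrite /inl !eq_lay. Qed.

Lemma own_sim : own (@lay G) u v = own (@lay G') u' v'.
Proof. by rewrite /own !eq_lay. Qed.

Lemma out_sim : outgoing (@lay G) u v = outgoing (@lay G') u' v'.
Proof. by rewrite /outgoing inl_sim !eq_lay (sim_ident su) (sim_ident sv). Qed.

Lemma depth_sim : depth L (@lay G) u v = depth L (@lay G') u' v'.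
Proof. by rewrite /depth inl_sim !eq_lay. Qed.

End Pair.

(** * Locality of one level *)

Section Level.
Variables (M K T B : nat).
Variables (cls lab gid : forall G : instance N, G -> G -> nat).
Hypothesis M_gt0 : 0 < M.
Hypothesis lab_lt : forall G (u v : G), lab u v < M.
Hypothesis B_geq : 2 * M + 2 <= B.
Hypothesis cls_local : elocal r B cls.
Hypothesis lab_local : elocal r B lab.
Hypothesis gid_local : elocal r B gid.

Local Notation depth G := (@depth N L G (@lay G)).
Local Notation slot G := (@slot N L M G (@lay G) (@lab G)).
Local Notation own G := (@own N G (@lay G)).
Local Notation outgoing G := (@outgoing N G (@lay G)).
Local Notation inl G := (@inl N G (@lay G)).
Local Notation bef G := (@before N L M G (@lay G) (@lab G)).
Local Notation key G := (@level_key N L M G (@lay G) (@lab G)).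
Local Notation col G := (@level_col N L M K T G (@lay G) (@cls G) (@lab G) (@gid G)).

Let elab G (u v : G) := if outgoing G u v then lab u v else lab v u.

Lemma slotE G (u v : G) : slot G u v = depth G u v * M + elab u v.
Proof. by []. Qed.

Lemma elab_lt G (u v : G) : elab u v < M.
Proof. by rewrite /elab; case: ifP. Qed.

Lemma elab_sim G G' (u v : G) (u' v' : G') : adj u v -> adj u' v' ->
  sim (r + B * depth G u v) u u' -> sim (r + B * depth G u v) v v' ->
  elab u v = elab u' v'.
Proof.
move=> uv uv' su sv; rewrite /elab (@out_sim G G' u v u' v'); try by apply: sim_leq; [|eassumption]; lia.
by case: ifP => _; apply: lab_local; rewrite // 1?adj_sym // depthC.
Qed.

Lemma slot_sim G G' (u v : G) (u' v' : G') : adj u v -> adj u' v' ->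
  sim (r + B * depth G u v) u u' -> sim (r + B * depth G u v) v v' ->
  slot G u v = slot G' u' v'.
Proof.
move=> uv uv' su sv; rewrite !slotE (elab_sim uv uv' su sv).
rewrite (@depth_sim G G' u v u' v') //; by apply: sim_leq; [|eassumption]; lia.
Qed.

Lemma slot_lt_deep G (u v w y : G) : depth G u v < depth G w y -> slot G u v < slot G w y.
Proof. by move=> lt_d; apply: slot_lt_depth. Qed.

(* radius at the head of the edge at which its colour is determined *)
Let rad G (u v : G) := r + B * depth G u v + 2 * elab u v + 2.

Lemma slot_leq_depth G (u v w y : G) : slot G w y <= slot G u v -> depth G w y <= depth G u v.
Proof. by apply: contraLR; rewrite -!ltnNge; apply: slot_lt_deep. Qed.

(** At equal depth a smaller label saves [2]; a smaller depth saves [B], which exceeds what all [M]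
    labels together can cost. *)
Lemma rad_lt_slot G (u v w y : G) : slot G w y < slot G u v ->
  rad w y <= r + B * depth G u v + 2 * elab u v.
Proof.
rewrite /rad => lt_s; have := elab_lt w y.
have := slot_leq_depth (ltnW lt_s); rewrite leq_eqVlt => /predU1P[eq_d|]; last by nia.
by move: lt_s; rewrite !slotE eq_d; lia.
Qed.

Lemma sim_both s G G' (u v : G) (u' v' : G') : adj v u -> adj v' u' ->
  ident u = ident u' -> sim s.+1 v v' -> sim s u u' /\ sim s v v'.
Proof.
move=> vu vu' eq_id sv; split; last exact: sim_leq sv.
exact: (sim_nbr_ident sv).
Qed.

Lemma rad_leq_slot G (u v w y : G) : slot G w y = slot G u v -> rad w y <= rad u v.
Proof.
rewrite /rad => eq_s.
have le_s : slot G u v <= slot G w y by rewrite eq_s.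
have eq_d : depth G w y = depth G u v.
  by apply/eqP; rewrite eqn_leq !slot_leq_depth ?eq_s.
by move: eq_s; rewrite !slotE eq_d; lia.
Qed.

Lemma beforeN_deep G (v y u : G) : depth G v u < depth G v y -> bef G v y u = false.
Proof. by move=> /slot_lt_deep lt_s; rewrite /before; lia. Qed.

(** Induction on the key. From the head, the tail is one step away and the neighbours of the tail
    are two steps away, and an earlier slot needs a radius smaller by two. An edge of the same slot
    is consulted only if it has the same head [v], so the radius at [v] need not shrink; this is why
    similarity is assumed at the head alone. *)
Lemma level_col_sim_head k G G' (u v : G) (u' v' : G') :
  key G (u, v) < k -> outgoing G u v -> adj u v -> adj u' v' -> ident u = ident u' ->
  sim (rad u v) v v' -> col G u v = col G' u' v'.
Proof.
elim: k G G' u v u' v' => [//|k IHk] G G' u v u' v' lt_k o uv uv' eq_id sv2.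
set R := r + B * depth G u v + 2 * elab u v.
have {}sv2 : sim R.+2 v v' by move: sv2; rewrite /rad -/R addn2.
have vu : adj v u by rewrite adj_sym.
have vu' : adj v' u' by rewrite adj_sym.
have [su1 sv1] := sim_both vu vu' eq_id sv2.
have leR : r + B * depth G u v <= R by rewrite /R; lia.
have ler : r <= R by rewrite /R; lia.
have su0 : sim (r + B * depth G u v) u u' by apply: sim_leq su1; lia.
have sv0 : sim (r + B * depth G u v) v v' by apply: sim_leq sv1; lia.
have sur : sim r u u' by apply: sim_leq su1; lia.
have svr : sim r v v' by apply: sim_leq sv1; lia.
have o' : outgoing G' u' v' by rewrite -(out_sim sur svr).
have IH (w y : G) (w' y' : G') : adj w y -> adj w' y' ->
    key G (w, y) < key G (u, v) -> sim (rad w y) w w' -> sim (rad w y) y y' ->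
    col G w y = col G' w' y'.
  move=> wy wy' lt_key sw sy; have lt_k' : key G (w, y) < k by lia.
  case: (boolP (outgoing G w y)) => ow.
    by apply: IHk => //; apply: sim_ident sw.
  rewrite level_colC [RHS]level_colC; apply: IHk => //.
  - by rewrite level_keyC.
  - by rewrite (outNC _ (adj_neq wy)).
  - by rewrite adj_sym.
  - by rewrite adj_sym.
  - exact: sim_ident sy.
  rewrite /rad depthC /elab (outNC _ (adj_neq wy)) (negPf ow).
  by move: sw; rewrite /rad /elab (negPf ow).
have eq_attr (w y : G) (w' y' : G') : adj w y -> adj w' y' ->
    sim R w w' -> sim R y y' -> depth G w y <= depth G u v ->
    [/\ slot G w y = slot G' w' y', cls w y = cls w' y' & gid w y = gid w' y'].
  move=> wy wy' sw sy le_d.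
  have le_R : r + B * depth G w y <= R by rewrite /R; nia.
  split; [apply: slot_sim | apply: cls_local | apply: gid_local] => //;
    exact: sim_leq le_R _.
have IHs (w y : G) (w' y' : G') : adj w y -> adj w' y' ->
    sim R w w' -> sim R y y' -> slot G w y < slot G u v ->
    col G w y = col G' w' y'.
  move=> wy wy' sw sy lt_s; have le_R := rad_lt_slot lt_s.
  apply: IH => //; [exact: lt_slot_key | exact: sim_leq le_R _ | exact: sim_leq le_R _].
have [eq_suv eq_cuv eq_guv] : [/\ slot G u v = slot G' u' v', cls u v = cls u' v'
    & gid u v = gid u' v'].
  by apply: eq_attr => //; [apply: sim_leq su1 | apply: sim_leq sv1]; lia.
have [eq_svu eq_cvu eq_gvu] : [/\ slot G v u = slot G' v' u', cls v u = cls v' u'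
    & gid v u = gid v' u'].
  apply: eq_attr => //; [apply: sim_leq sv1 | apply: sim_leq su1 |]; try lia.
  by rewrite depthC.
rewrite !level_col_out //; apply: eq_find => c /=; congr (~~ (_ || _)).
  rewrite /tail_forbids; congr (0 < _); apply: (cnt_sim su1) => y y' uy uy' sy /=.
  have su : sim R u u' by exact: sim_leq (leqnSn _) su1.
  have suy : sim r y y' by apply: sim_leq ler sy.
  (* The labels of deeper edges may not be visible at this radius, but such edges are later in both
     instances and hence not counted. *)
  rewrite (own_sim sur suy); case: (leqP (depth G u y) (depth G u v)) => [le_d|lt_d].
    have [eq_s eq_c eq_g] := eq_attr _ _ _ _ uy uy' su sy le_d.
    rewrite -eq_s -eq_suv -eq_c -eq_cuv -eq_g -eq_guv.
    by case: ltnP => [lt_s|]; rewrite ?andbF //; rewrite (IHs _ _ _ _ uy uy').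
  have /slot_lt_deep : depth G' u' v' < depth G' u' y'.
    by rewrite -(depth_sim sur svr) -(depth_sim sur suy).
  move=> lt_s'; rewrite (leq_gtF (ltnW (slot_lt_deep lt_d))) (leq_gtF (ltnW lt_s')).
  by rewrite !andbF.
have eq_before (y : G) (y' : G') : adj v y -> adj v' y' -> sim R.+1 y y' ->
    bef G v y u = bef G' v' y' u' /\
    (bef G v y u -> [/\ cls v y = cls v' y', gid v y = gid v' y' &
       col G v y = col G' v' y']).
  move=> vy vy' sy1; have sv : sim R v v' by apply: sim_leq (leqnSn _) sv1.
  have sy : sim R y y' by apply: sim_leq (leqnSn _) sy1.
  have syr : sim r y y' by apply: sim_leq (leqW ler) sy1.
  case: (leqP (depth G v y) (depth G v u)) => [le_d|lt_d]; last first.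
    rewrite !beforeN_deep //; first by rewrite -(depth_sim svr sur) -(depth_sim svr syr).
  rewrite (depthC _ _ v u) in le_d.
  have [eq_s eq_c eq_g] := eq_attr _ _ _ _ vy vy' sv sy le_d.
  split.
    rewrite /before eq_s eq_svu (out_sim syr svr).
    by rewrite (sim_ident sy) eq_id.
  move=> lt_b; split=> //; have lt_key := before_key o lt_b.
  case/orP: lt_b => [lt_s|/and3P[/eqP eq_svy oyv lt_id]].
    by apply: IHs => //; rewrite (slotC _ _ _ _ u).
  rewrite level_colC [RHS]level_colC; apply: IHk => //.
  - by rewrite level_keyC; apply: leq_trans lt_key _; rewrite level_keyC.
  - by rewrite adj_sym.
  - by rewrite adj_sym.
  - exact: sim_ident sy.
  suff: rad y v <= R.+2 by move/sim_leq; apply.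
  have := @rad_leq_slot G u v y v; rewrite {2}/rad -/R addn2; apply.
  by rewrite slotC eq_svy slotC.
rewrite /head_forbids (inl_sim sur svr).
case: (inl G' u' v').
  congr (0 < _); apply: (cnt_sim sv2) => y y' vy vy' sy1 /=.
  have syr : sim r y y' by apply: sim_leq (leqW ler) sy1.
  have [eq_b eq_cg] := eq_before y y' vy vy' sy1.
  rewrite (own_sim svr syr) -eq_b -eq_cvu -eq_gvu.
  by case: (boolP (bef G v y u)) eq_cg => [_ [//|-> -> ->]|_ _]; rewrite ?andbF.
congr (T <= _); apply: (cnt_sim sv2) => y y' vy vy' sy1 /=.
have [eq_b eq_cg] := eq_before y y' vy vy' sy1.
rewrite -eq_b -eq_cvu.
by case: (boolP (bef G v y u)) eq_cg => [_ [//|-> _ ->]|_ _]; rewrite ?andbF.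
Qed.

(** A level adds [B] to the base radius, since the labels below [M] cost at most [2 * M]. *)
Lemma level_col_local : elocal (r + B) B (fun G => col G).
Proof.
move=> G G' u v u' v' uv uv' su sv.
have le_rad : rad u v <= r + B + B * depth G u v.
  by rewrite /rad; have := elab_lt u v; lia.
case: (boolP (outgoing G u v)) => o.
  apply: (@level_col_sim_head (key G (u, v)).+1) => //; first exact: sim_ident su.
  exact: sim_leq sv.
rewrite level_colC [RHS]level_colC.
apply: (@level_col_sim_head (key G (v, u)).+1); rewrite ?(outNC _ (adj_neq uv)) //.
- by rewrite adj_sym.
- by rewrite adj_sym.
- exact: sim_ident sv.
apply: sim_leq su; apply: leq_trans le_rad.
by rewrite /rad depthC /elab (outNC _ (adj_neq uv)) (negPf o).
Qed.

End Level.
End WithLay.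
End DepthLocality.

(** * Grouping the edges that a vertex owns *)

Section Rank.
Variables (N L M : nat) (G : instance N) (lay : G -> nat) (cls : G -> G -> nat).
Implicit Types (u v w y : G).

Local Notation own := (own lay).
Local Notation outgoing := (outgoing lay).
Local Notation inl := (inl lay).
Local Notation depth := (depth L lay).

(* Edges inside a layer come first, so that their rank does not depend on the classes of
   the edges to higher layers, which are coloured later. *)
Definition own_order v y := ~~ inl v y * N + ident y.

Definition rank v w := cnt v (fun y =>
  [&& own v y, outgoing v y == outgoing v w, own_order v y < own_order v w & cls v y == cls v w]).

Lemma own_order_inj v : injective (own_order v).
Proof.
move=> y w; have := ident_lt y; have := ident_lt w; rewrite /own_order => lt1 lt2 e.
by apply: (@ident_inj _ G); case: (inl v y) e; case: (inl v w) => /=; lia.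
Qed.

(** Hence a rank depends only on classes of edges no deeper than the ranked one, as the pipelined
    locality requires. *)
Lemma own_order_depth v y w : own v y -> outgoing v y = outgoing v w ->
  own_order v y < own_order v w -> depth v y <= depth v w.
Proof.
have := ident_lt y; have := ident_lt w.
rewrite /own_order /outgoing /inl /own /depth /inl.
by case: (ltngtP (lay v) (lay y)); case: (ltngtP (lay v) (lay w)) => //= *; lia.
Qed.

Lemma rank_lt v w : adj v w -> own v w ->
  rank v w < cnt v (fun y => [&& own v y, outgoing v y == outgoing v w & cls v y == cls v w]).
Proof.
move=> vw ow; apply: (@cnt_ltn _ _ _ _ _ w); rewrite ?ltnn ?ow ?eqxx //=.
by move=> y _ /and4P[-> -> _ ->].
Qed.

Lemma rank_inj v y w : adj v y -> adj v w -> own v y -> own v w ->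
  outgoing v y = outgoing v w -> cls v y = cls v w -> rank v y = rank v w -> y = w.
Proof.
have H a b : adj v a -> own v a -> outgoing v a = outgoing v b -> cls v a = cls v b ->
    own_order v a < own_order v b -> rank v a < rank v b.
  move=> va oa eo ec lt_ab; apply: (@cnt_ltn _ _ _ _ _ a) => //.
  - move=> z _ /and4P[-> /eqP-> lt_za /eqP->]; rewrite eo ec !eqxx andbT.
    exact: ltn_trans lt_za lt_ab.
  - by rewrite oa eo ec lt_ab !eqxx.
  by rewrite ltnn /= !andbF.
move=> vy vw oy ow eo ec er; apply: (@own_order_inj v).
case: (ltngtP (own_order v y) (own_order v w)) => // [/H|/H].
  by move/(_ vy oy eo ec); rewrite er ltnn.
by move/(_ vw ow (esym eo) (esym ec)); rewrite er ltnn.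
Qed.

Section Groups.
Variable m : nat.
Hypothesis m_gt0 : 0 < m.

(** Runs of [m] consecutive ranks; the parity keeps incoming and outgoing edges in separate
    groups. *)
Definition group_of v w := outgoing v w + 2 * (rank v w %/ m).
Definition label_of u v := rank u v %% m.

Lemma group_ofP v y w : group_of v y = group_of v w ->
  outgoing v y = outgoing v w /\ rank v y %/ m = rank v w %/ m.
Proof.
rewrite /group_of; case: (outgoing v y); case: (outgoing v w) => /=; lia.
Qed.

Lemma rank_divn_modn v y w : group_of v y = group_of v w ->
  label_of v y = label_of v w -> rank v y = rank v w.
Proof.
move=> /group_ofP[_ eq_d]; rewrite /label_of => eq_m.
by rewrite (divn_eq (rank v y) m) eq_d eq_m -divn_eq.
Qed.

Lemma group_leq v w : 
  cnt v (fun y => [&& own v y, cls v y == cls v w & group_of v y == group_of v w]) <= m.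
Proof.
apply: (@cnt_inj _ _ _ _ (label_of v)) => [y _ _|]; first by rewrite ltn_mod.
move=> y z vy vz /and3P[oy /eqP cy /eqP gy] /and3P[oz /eqP cz /eqP gz] eq_l.
have eq_g : group_of v y = group_of v z by rewrite gy gz.
have [eq_o _] := group_ofP eq_g.
by apply: (@rank_inj v); rewrite ?cy ?cz ?(rank_divn_modn eq_g eq_l).
Qed.

(** The label in a slot is that of the tail. So for outgoing edges of one group equal slots give
    equal ranks; for incoming edges the labels belong to the other ends and may coincide. *)
Lemma group_sched v y w : m <= M -> adj v y -> adj v w -> own v y -> own v w ->
  cls v y = cls v w -> group_of v y = group_of v w ->
  slot L M lay label_of v y = slot L M lay label_of v w -> y != w ->
  ~~ outgoing v y /\ ~~ outgoing v w.
Proof.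
move=> le_mM vy vw oy ow ec eg es yw; have [eo _] := group_ofP eg.
suff no : ~~ outgoing v y by rewrite -eo.
apply: contra yw => outy; apply/eqP; apply: (@rank_inj v) => //; apply: (rank_divn_modn eg).
have ltM u z : label_of u z < M by apply: leq_trans le_mM; rewrite ltn_mod.
have := congr1 (modn ^~ M) es; rewrite /slot -eo outy !modnMDl.
by rewrite !modn_small.
Qed.

(** A letter occurs at most once per group, so the number of groups is an upper bound. The surplus
    [2] pays for rounding up once per direction, and it reappears in the result, so that the bound
    can be iterated. *)
Lemma group_count (col : G -> G -> nat) v k c Q :
  (forall y w, adj v y -> adj v w -> own v y -> own v w ->
    cls v y = cls v w -> group_of v y = group_of v w -> y != w -> col v y != col v w) ->
  cnt v (fun y => own v y && (cls v y == k)) <= Q.+2 ->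
  cnt v (fun y => [&& own v y, cls v y == k & col v y == c]) <= (Q %/ m).+2.
Proof.
move=> proper le_Q.
pose n (b : bool) := cnt v (fun y => [&& own v y, outgoing v y == b & cls v y == k]).
have part (b : bool) : cnt v (fun y =>
    [&& own v y, cls v y == k & col v y == c] && (outgoing v y == b)) <= (n b + m.-1) %/ m.
  apply: (@cnt_inj _ _ _ _ (fun y => rank v y %/ m)).
    move=> y vy /andP[/and3P[oy /eqP ck _] /eqP ob].
    have lt_n : rank v y < n b by rewrite /n -ob -ck; apply: rank_lt.
    by rewrite leq_divRL // mulSn; have := leq_divM (rank v y) m; lia.
  move=> y w vy vw /andP[/and3P[oy /eqP ck /eqP cy] /eqP ob].
  move=> /andP[/and3P[ow /eqP ck' /eqP cw] /eqP ob'] eq_r.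
  apply/eqP; apply/negPn/negP => /(proper y w vy vw oy ow); rewrite ck ck' cy cw eqxx.
  by move/(_ erefl); rewrite /group_of ob ob' eq_r => /(_ erefl).
have le_n : n true + n false <= Q.+2.
  rewrite (leq_trans _ le_Q) // (cnt_split _ _ (fun y => outgoing v y)).
  by apply: leq_add; apply: cnt_leq => y _ /and3P[-> /eqP -> ->].
rewrite (cnt_split _ _ (fun y => outgoing v y)).
apply: (@leq_trans ((n true + m.-1) %/ m + (n false + m.-1) %/ m)).
  apply: leq_add; [apply: leq_trans (part true) | apply: leq_trans (part false)];
    by apply: cnt_leq => y _ /andP[-> /=]; case: (outgoing v y).
have -> : (Q %/ m).+2 = (Q + 2 * m) %/ m by rewrite addnC divnMDl // add2n.
rewrite leq_divRL // mulnDl.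
have := leq_divM (n true + m.-1) m; have := leq_divM (n false + m.-1) m; lia.
Qed.

End Groups.

Section FinalLabels.
Variables (m : nat) (aux : G -> G -> nat).

(** Crossing edges are told apart at their tail by rank, edges inside a layer by a schedule [aux]
    valid at both ends. The reduction modulo [M] bounds labels on arbitrary pairs of vertices, not
    only on edges. *)
Definition final_label u v := (if inl u v then aux u v else rank u v) %% M.

(** A slot determines depth and label, and depth [0] singles out the edges inside the layer; within
    either kind the label is injective on a class. *)
Lemma final_sched v y w : m <= M -> 0 < M ->
  (forall u v, aux u v = aux v u) -> (forall u v, adj u v -> inl u v -> aux u v < M) ->
  (forall y w, adj v y -> adj v w -> inl v y -> inl v w -> cls v y = cls v w ->
     y != w -> aux v y != aux v w) ->
  (forall k, cnt v (fun y => own v y && (cls v y == k)) <= m) ->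
  adj v y -> adj v w -> own v y -> own v w -> cls v y = cls v w ->
  slot L M lay final_label v y = slot L M lay final_label v w -> y = w.
Proof.
move=> le_mM M_gt0 auxC aux_lt aux_proper own_leq vy vw oy ow ec es.
have ltM u z : final_label u z < M by rewrite ltn_mod.
have ltM2 u z : (if outgoing u z then final_label u z else final_label z u) < M.
  by case: ifP.
have eq_d : depth v y = depth v w.
  have := congr1 (divn ^~ M) es; rewrite /slot !divnMDl // !divn_small //.
  by rewrite !addn0.
have eq_l : (if outgoing v y then final_label v y else final_label y v) =
            (if outgoing v w then final_label v w else final_label w v).
  have := congr1 (modn ^~ M) es; rewrite /slot !modnMDl.
  by rewrite !(modn_small (ltM2 _ _)).
have eq_i : inl v y = inl v w.
  by move: eq_d; rewrite /depth; case: (inl v y); case: (inl v w).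
case: (boolP (inl v y)) => iy.
  have iw : inl v w by rewrite -eq_i.
  have auxE z : adj v z -> inl v z ->
      (if outgoing v z then final_label v z else final_label z v) = aux v z.
    move=> vz iz; rewrite /final_label (inlC _ z) iz (auxC z) if_same.
    by rewrite modn_small // aux_lt.
  apply/eqP/negPn/negP => yw; have := aux_proper y w vy vw iy iw ec yw.
  by move: eq_l; rewrite !auxE // => ->; rewrite eqxx.
have iw : ~~ inl v w by rewrite -eq_i.
have rankE z : adj v z -> own v z -> ~~ inl v z ->
    (if outgoing v z then final_label v z else final_label z v) = rank v z.
  move=> vz oz iz; rewrite (outE oz) iz /final_label (negPf iz) modn_small //.
  apply: leq_trans le_mM; apply: leq_trans (own_leq (cls v z)).
  apply: leq_trans (rank_lt vz oz) _; apply: cnt_leq => t _.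
  by move=> /and3P[-> _ ->].
move: eq_l; rewrite !rankE // => eq_r; apply: (rank_inj vy vw oy ow _ ec eq_r).
by rewrite (outE oy) (outE ow) iy iw.
Qed.

End FinalLabels.
End Rank.

Section RankLocality.
Variables (N L : nat) (lay : forall G : instance N, G -> nat).
Variables (r B : nat) (cls : forall G : instance N, G -> G -> nat).
Hypothesis lay_local : vlocal r lay.
Hypothesis cls_local : elocal L lay r B cls.

Lemma rank_local : elocal L lay r.+1 B (fun G => rank (@lay G) (@cls G)).
Proof.
move=> G G' v w v' w' vw vw' sv sw; rewrite addSn in sv sw.
have sv0 := sim_leq (leqnSn _) sv; have sw0 := sim_leq (leqnSn _) sw.
have le_r : r <= r + B * depth L (@lay G) v w by apply: leq_addr.
have svr := sim_leq le_r sv0; have swr := sim_leq le_r sw0.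
apply: (cnt_sim sv) => y y' vy vy' sy /=; have syr := sim_leq le_r sy.
have ordE (z : G) (z' : G') : sim r z z' ->
    own_order (@lay G) v z = own_order (@lay G') v' z'.
  by move=> sz; rewrite /own_order (inl_sim lay_local svr sz) (sim_ident sz).
rewrite -(own_sim lay_local svr syr) -(out_sim lay_local svr syr).
rewrite -(out_sim lay_local svr swr) -(ordE y y') // -(ordE w w') //.
rewrite (cls_local vw vw' sv0 sw0).
case: (boolP (own _ v y)) => //= oy; case: eqP => //= eo; case: ltnP => //= lt_o.
congr (_ == _); have le_d := own_order_depth L oy eo lt_o.
apply: cls_local => //; first by apply: sim_leq sv0; rewrite leq_add2l leq_mul2l le_d orbT.
by apply: sim_leq sy; rewrite leq_add2l leq_mul2l le_d orbT.
Qed.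

Lemma group_local m : elocal L lay r.+1 B (fun G => group_of (@lay G) (@cls G) m).
Proof.
move=> G G' v w v' w' vw vw' sv sw.
have le_r : r <= r.+1 + B * depth L (@lay G) v w by lia.
rewrite /group_of (rank_local vw vw' sv sw).
by rewrite (out_sim lay_local (sim_leq le_r sv) (sim_leq le_r sw)).
Qed.

Lemma label_local m : elocal L lay r.+1 B (fun G => label_of (@lay G) (@cls G) m).
Proof. by move=> G G' v w v' w' vw vw' sv sw; congr modn; apply: rank_local. Qed.

End RankLocality.

(** * Cole-Vishkin colour reduction *)

Definition bit i a := odd (a %/ 2 ^ i).

(** Both numbers are below [2 ^ (a + b)], so the range contains a differing position whenever
    [a != b]. *)
Definition diffbit a b := find (fun i => bit i a != bit i b) (iota 0 (a + b)).

(* The second argument is [0] at the end of a path and [b.+1] if the next colour is [b]. *)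
Definition cv a nb : nat :=
  if nb is b.+1 then 2 * diffbit a b + bit (diffbit a b) a else odd a.

Definition cv_bits h := up_log 2 (2 * h).

Lemma ex_diffbit h a b : a < 2 ^ h -> b < 2 ^ h -> a != b ->
  exists2 i, i < h & bit i a != bit i b.
Proof.
elim: h a b => [|h IHh] a b; first by rewrite expn0 !ltnS !leqn0 => /eqP-> /eqP->.
rewrite expnS => lt_a lt_b ab.
case: (boolP (odd a == odd b)) => [/eqP eq_o|no]; last first.
  by exists 0; rewrite // /bit expn0 !divn1.
have [||| i lt_ih ne_i] := IHh (a %/ 2) (b %/ 2).
- by rewrite ltn_divLR // mulnC.
- by rewrite ltn_divLR // mulnC.
- apply: contraNneq ab => eq_h; have := divn_eq a 2; have := divn_eq b 2.
  by rewrite !modn2 eq_o eq_h => <- ->.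
by exists i.+1; rewrite // /bit expnS !divnMA.
Qed.

Lemma diffbitP h a b : a < 2 ^ h -> b < 2 ^ h -> a != b ->
  diffbit a b < h /\ bit (diffbit a b) a != bit (diffbit a b) b.
Proof.
move=> lt_a lt_b ab; pose P i := bit i a != bit i b.
have [i1 lt_i1 Pi1] : exists2 i, i < a + b & P i.
  by apply: ex_diffbit => //; apply: leq_trans (ltn_expl _ (ltnSn 1)) _;
    rewrite leq_exp2l // ?leq_addr ?leq_addl.
have hasP : has P (iota 0 (a + b)).
  by apply/hasP; exists i1; rewrite // mem_iota.
have lt_d : diffbit a b < a + b by rewrite -[ltnRHS](size_iota 0) -has_find.
split; last by have := nth_find 0 hasP; rewrite nth_iota.
have [i lt_ih Pi] := ex_diffbit lt_a lt_b ab.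
rewrite ltnNge; apply: contraTN Pi => le_hd.
have lt_id : i < diffbit a b by apply: leq_trans le_hd.
have := before_find 0 lt_id; rewrite nth_iota ?add0n => [->//|].
exact: ltn_trans lt_d.
Qed.

Definition cv_compatible a nb := if nb is b.+1 then a != b else true.

Lemma cv_lt h a nb : 0 < h -> a < 2 ^ h -> nb <= 2 ^ h -> cv_compatible a nb ->
  cv a nb < 2 * h.
Proof.
case: nb => [|b] h_gt0 lt_a lt_b /=; first by case: (odd a) => _ /=; lia.
by move=> /(diffbitP lt_a lt_b)[]; case: (bit _ a) => /=; lia.
Qed.

(** If the two positions agree, the bits at this position differ by choice of [diffbit]. The end of
    a path behaves as if position [0] had been chosen. *)
Lemma cv_neq a b nc : a != b -> cv_compatible b nc -> cv a b.+1 != cv b nc.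
Proof.
have big c1 c2 : c1 < 2 ^ (c1 + c2) /\ c2 < 2 ^ (c1 + c2).
  by split; apply: leq_trans (ltn_expl _ (ltnSn 1)) _;
    rewrite leq_exp2l // ?leq_addr ?leq_addl.
move=> ab; have [_ ne_ab] := diffbitP (big a b).1 (big a b).2 ab.
case: nc => [_|c bc] /=.
  apply: contra ne_ab => /eqP.
  have [->|d_gt0] := posnP (diffbit a b); last by case: (odd b); lia.
  by rewrite /bit expn0 !divn1; case: (odd a); case: (odd b).
apply: contra ne_ab => /eqP eq_cv.
have [] : diffbit a b = diffbit b c /\ bit (diffbit a b) a = bit (diffbit b c) b.
  by move: eq_cv; case: (bit _ a); case: (bit _ b) => /=; lia.
by move=> -> ->.
Qed.

(** [cv_bits] strictly decreases numbers above [3] and preserves being at most [3], so the colours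
    end up below [8]. *)
Lemma iter_cv_bits h : iter h cv_bits h <= 3.
Proof.
have small k h' : h' <= 3 -> iter k cv_bits h' <= 3.
  elim: k => //= k IHk /IHk; case: (iter k cv_bits h') => [|[|[|[|//]]]] _ //.
suff H k h' : h' <= k.+3 -> iter k cv_bits h' <= 3 by apply: H; lia.
elim: k h' => // k IHk h' le_h; case: (leqP h' 3) => [/small //|lt3].
rewrite iterSr; apply: IHk; apply: leq_trans (_ : h'.-1 <= _); last by lia.
apply: up_log_min => //; case: h' lt3 {le_h} => // h'; rewrite ltnS /=.
elim: h' => // h' IHh; rewrite leq_eqVlt => /predU1P[<- //|/IHh].
by rewrite expnS; lia.
Qed.

(** * Colour reduction on directed paths inside the layers *)

Section Paths.
Variables (N : nat) (G : instance N) (lay : G -> nat) (cls sep : G -> G -> nat).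
Implicit Types (u v w : G).

Local Notation inl := (inl lay).
Local Notation outgoing := (outgoing lay).

Definition next_on_path u v w :=
  [&& inl v w, outgoing v w, cls v w == cls u v & sep v w == sep u v].

(** When [sep] cuts a class into paths, the sum has at most one nonzero term and is thus the second
    argument expected by [cv]. *)
Fixpoint path_col k u v :=
  if k is k'.+1
  then cv (path_col k' u v)
          (\sum_(w | adj v w) next_on_path u v w * (path_col k' v w).+1)
  else ident u.

Definition schedule k u v :=
  if outgoing u v then sep u v * 8 + path_col k u v else sep v u * 8 + path_col k v u.

Hypothesis clsC : forall u v, cls u v = cls v u.
Hypothesis sepC : forall u v, sep u v = sep v u.
Hypothesis sep_proper : forall v y w, adj v y -> adj v w -> inl v y -> inl v w ->
  cls v y = cls v w -> sep v y = sep v w -> y != w -> outgoing v y != outgoing v w.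

Lemma next_sum (u v : G) (g : G -> nat) :
  (exists2 w, adj v w && next_on_path u v w &
     \sum_(w | adj v w) next_on_path u v w * (g w).+1 = (g w).+1) \/
  (forall w, adj v w -> ~~ next_on_path u v w) /\
     \sum_(w | adj v w) next_on_path u v w * (g w).+1 = 0.
Proof.
have [w /andP[vw nw]|none] := pickP (fun w => adj v w && next_on_path u v w).
  left; exists w; first by rewrite vw.
  rewrite (bigD1 w) //= nw mul1n big1 ?addn0 // => y /andP[vy yw].
  case: (boolP (next_on_path u v y)) => // ny.
  case/and4P: nw => iw ow /eqP cw /eqP sw; case/and4P: ny => iy oy /eqP cy /eqP sy.
  by have := sep_proper vy vw iy iw; rewrite cy cw sy sw oy ow => /(_ erefl erefl yw).
right; have H w : adj v w -> ~~ next_on_path u v w.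
  by move=> vw; have := none w; rewrite /= vw /= => ->.
by split=> //; apply: big1 => w /H /negPf ->.
Qed.

Lemma path_col_next k u v w : adj u v -> adj v w -> inl u v -> outgoing u v ->
  next_on_path u v w -> path_col k u v != path_col k v w.
Proof.
elim: k u v w => [|k IHk] u v w uv vw iuv ouv nw /=.
  by rewrite (inj_eq (@ident_inj _ G)) (adj_neq uv).
have [[w' /andP[vw' nw'] ->]|[none _]] := next_sum u v (path_col k v); last first.
  by rewrite (negPf (none w vw)) in nw.
have {w' nw' vw'} -> : w' = w.
  apply/eqP/negPn/negP => ww'.
  case/and4P: nw => iw ow /eqP cw /eqP sw; case/and4P: nw' => iy oy /eqP cy /eqP sy.
  by have := sep_proper vw' vw iy iw; rewrite cy cw sy sw oy ow => /(_ erefl erefl ww').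
have [iw ow _ _] := and4P nw.
apply: cv_neq; first exact: IHk.
by have [[z /andP[wz nz] ->]|[_ ->]] := next_sum v w (path_col k w) => //=; apply: IHk.
Qed.

Lemma path_col_lt h k u v : 0 < h -> N <= 2 ^ h -> adj u v -> inl u v -> outgoing u v ->
  path_col k u v < 2 ^ iter k cv_bits h.
Proof.
move=> h_gt0 leN.
have iter_gt0 j : 0 < iter j cv_bits h.
  by elim: j => // j IHj; rewrite iterS [cv_bits _]/cv_bits up_log_gt0 /=; lia.
elim: k u v => [|k IHk] u v uv iuv ouv /=; first exact: leq_trans (ident_lt u) leN.
apply: leq_trans (up_logP _ (ltnSn 1)).
apply: cv_lt => //; first exact: IHk.
  have [[w /andP[vw nw] ->]|[_ -> //]] := next_sum u v (path_col k v).
  by have [iw ow _ _] := and4P nw; apply: IHk.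
have [[w /andP[vw nw] ->]|[_ -> //]] := next_sum u v (path_col k v).
exact: path_col_next.
Qed.

Lemma scheduleC k u v : schedule k u v = schedule k v u.
Proof.
have [->//|uv] := eqVneq u v.
by rewrite /schedule (outNC _ uv); case: (outgoing u v).
Qed.

Lemma scheduleE k u v : adj u v ->
  schedule k u v = sep u v * 8 + (if outgoing u v then path_col k u v else path_col k v u).
Proof. by rewrite /schedule (sepC v u); case: ifP. Qed.

Section Bounded.
Variables (h k : nat).
Hypothesis h_gt0 : 0 < h.
Hypothesis leN : N <= 2 ^ h.
Hypothesis reduced : iter k cv_bits h <= 3.

Lemma path_col_lt8 u v : adj u v -> inl u v ->
  (if outgoing u v then path_col k u v else path_col k v u) < 8.
Proof.
move=> uv iuv; have le8 : 2 ^ iter k cv_bits h <= 8 by rewrite (leq_exp2l _ 3).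
case: (boolP (outgoing u v)) => ouv; apply: leq_trans le8; apply: path_col_lt => //.
- by rewrite adj_sym.
- by rewrite inlC.
by rewrite (outNC _ (adj_neq uv)).
Qed.

Lemma schedule_lt S u v : adj u v -> inl u v -> sep u v < S -> schedule k u v < S * 8.
Proof. by move=> uv iuv lt_s; rewrite scheduleE //; have := path_col_lt8 uv iuv; lia. Qed.

(** Edges with equal schedule agree in [sep] and in path colour. By [sep_proper] one enters [v] and
    the other leaves it, so they are consecutive on a path, where path colours differ. *)
Lemma schedule_proper v y w : adj v y -> adj v w -> inl v y -> inl v w ->
  cls v y = cls v w -> y != w -> schedule k v y != schedule k v w.
Proof.
wlog ovw : y w / outgoing v y ==> outgoing v w.
  move=> H vy vw iy iw ec yw; case: (boolP (outgoing v y ==> outgoing v w)) => o.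
    exact: H.
  by rewrite eq_sym; apply: H => //; [move: o; case: (outgoing v y); case: (outgoing v w) | rewrite eq_sym].
move=> vy vw iy iw ec yw; rewrite !scheduleE //; apply/eqP => eq_s.
have := path_col_lt8 vy iy; have := path_col_lt8 vw iw => lt_w lt_y.
have es : sep v y = sep v w by lia.
have ep : (if outgoing v y then path_col k v y else path_col k y v) =
  (if outgoing v w then path_col k v w else path_col k w v) by lia.
have no := sep_proper vy vw iy iw ec es yw.
have ny : outgoing v y = false by move: ovw no; case: (outgoing v y); case: (outgoing v w).
have ow : outgoing v w by move: no; rewrite ny; case: (outgoing v w).
move: ep; rewrite ny ow; apply/eqP; apply: path_col_next => //.
- by rewrite adj_sym.
- by rewrite inlC.
- by rewrite (outNC _ (adj_neq vy)) ny.
by rewrite /next_on_path iw ow (clsC y) (sepC y) ec es !eqxx.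
Qed.

End Bounded.
End Paths.

Section PathLocality.
Variables (N L : nat) (lay : forall G : instance N, G -> nat).
Variables (r B : nat) (cls sep : forall G : instance N, G -> G -> nat).
Hypothesis lay_local : vlocal r lay.
Hypothesis cls_local : elocal L lay r B cls.
Hypothesis sep_local : elocal L lay r B sep.

Lemma path_col_local k :
  elocal L lay (r + k) B (fun G => path_col (@lay G) (@cls G) (@sep G) k).
Proof.
elim: k => [|k IHk] G G' u v u' v' uv uv' su sv /=; first exact: sim_ident su.
have le_k : r + k + B * depth L (@lay G) u v <= r + k.+1 + B * depth L (@lay G) u v by lia.
have le_r : r + B * depth L (@lay G) u v <= r + k.+1 + B * depth L (@lay G) u v by lia.
rewrite (IHk _ _ _ _ _ _ uv uv' (sim_leq le_k su) (sim_leq le_k sv)); congr cv.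
rewrite addnS addSn in sv; apply: (sum_sim sv) => w w' vw vw' sw.
have {}sv := sim_leq (leqnSn _) sv.
have le_r2 : r <= r + k + B * depth L (@lay G) u v by lia.
have svr := sim_leq le_r2 sv; have swr := sim_leq le_r2 sw.
rewrite /next_on_path -(inl_sim lay_local svr swr) -(out_sim lay_local svr swr).
case: (boolP (inl _ v w)) => //= ivw.
have d0 : depth L (@lay G) v w = 0 by rewrite /depth ivw.
have le_k2 : r + k <= r + k + B * depth L (@lay G) u v by lia.
have svk := sim_leq le_k2 sv; have swk := sim_leq le_k2 sw.
have -> : path_col (@lay G) (@cls G) (@sep G) k v w =
    path_col (@lay G') (@cls G') (@sep G') k v' w'.
  by apply: IHk; rewrite ?d0 ?muln0 ?addn0.
have -> : cls v w = cls v' w' by apply: cls_local; rewrite ?d0 ?muln0 ?addn0.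
have -> : sep v w = sep v' w' by apply: sep_local; rewrite ?d0 ?muln0 ?addn0.
have {}su := sim_leq le_r su.
have {}sv : sim (r + B * depth L (@lay G) u v) v v' by apply: sim_leq sv; lia.
by rewrite (cls_local uv uv' su sv) (sep_local uv uv' su sv).
Qed.

Lemma schedule_local k :
  elocal L lay (r + k) B (fun G => schedule (@lay G) (@cls G) (@sep G) k).
Proof.
move=> G G' u v u' v' uv uv' su sv; rewrite /schedule.
have le_r : r <= r + k + B * depth L (@lay G) u v by lia.
have le_r2 : r + B * depth L (@lay G) u v <= r + k + B * depth L (@lay G) u v by lia.
rewrite (out_sim lay_local (sim_leq le_r su) (sim_leq le_r sv)).
have vu : adj v u by rewrite adj_sym.
have vu' : adj v' u' by rewrite adj_sym.
case: ifP => _.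
  by rewrite (path_col_local uv uv' su sv) (sep_local uv uv' (sim_leq le_r2 su) (sim_leq le_r2 sv)).
rewrite (@path_col_local _ _ _ v u v' u') //; try by rewrite depthC.
by rewrite (@sep_local _ _ v u v' u') // depthC; apply: sim_leq le_r2 _.
Qed.

End PathLocality.

(** * Layers and forests *)

Section Layers.
Variables (N d : nat).
Implicit Types (G : instance N).

Fixpoint alive G k (v : G) : bool :=
  if k is k'.+1 then alive k' v && (d < cnt v (alive k')) else true.

(** The number of peeling rounds survived, cut off at [L]; a vertex still alive after [L] rounds has
    the value [L]. *)
Definition layer L G (v : G) : nat := \sum_(k < L) alive k.+1 v.

Lemma alive_local k G G' (v : G) (v' : G') : sim k v v' -> alive k v = alive k v'.
Proof.
elim: k G G' v v' => //= k IHk G G' v v' sv.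
rewrite (IHk _ _ _ _ (sim_leq (leqnSn k) sv)); congr (_ && (_ < _)).
by apply: (cnt_sim sv) => y y' _ _; apply: IHk.
Qed.

Lemma layer_local L : vlocal L (@layer L).
Proof.
move=> G G' v v' sv; apply: eq_bigr => k _.
by congr nat_of_bool; apply: alive_local; apply: sim_leq sv.
Qed.

Lemma layer_leq L G (v : G) : layer L v <= L.
Proof.
rewrite -[leqRHS]card_ord -sum1_card; apply: leq_sum => k _.
by case: (alive _ v).
Qed.

Lemma leq_layer L G k (v : G) : k <= L -> (k <= layer L v) = alive k v.
Proof.
elim: L k => [|L IHL] k; first by rewrite leqn0 => /eqP->.
have alive_leq : alive L v -> layer L v = L.
  by move=> aL; apply/eqP; rewrite eqn_leq layer_leq IHL.
rewrite leq_eqVlt ltnS /layer big_ord_recr /= -/(layer L v).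
case aL: (alive L v) alive_leq => /= alive_leq.
  rewrite alive_leq //; case: (d < _) / idP => dL /predU1P[->|le_kL] /=.
  - by rewrite aL dL addn1 leqnn.
  - by rewrite -IHL // alive_leq // le_kL addn1 leqW.
  - by rewrite aL; move/negP/negPf: dL => ->; rewrite addn0 ltnn.
  by rewrite -IHL // alive_leq // addn0 le_kL.
rewrite addn0 => /predU1P[->|le_kL]; last exact: IHL.
by rewrite /= aL ltnNge layer_leq.
Qed.

(** When [v] was peeled off it had at most [d] live neighbours, and these are exactly the ones in
    its own or higher layers. *)
Lemma own_layer_leq L G (v : G) : (forall u : G, ~~ alive L u) ->
  cnt v (own (@layer L G) v) <= d.
Proof.
move=> dead; have lt_L : layer L v < L.
  rewrite ltn_neqAle layer_leq andbT; apply: contra (dead v) => /eqP eL.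
  by rewrite -(leq_layer v (leqnn L)) eL.
have : ~~ alive (layer L v).+1 v by rewrite -(leq_layer v lt_L) ltnn.
rewrite /= -(leq_layer v (ltnW lt_L)) leqnn /=.
rewrite -leqNgt; apply: leq_trans; apply: cnt_leq => y _.
by rewrite /own (leq_layer y (ltnW lt_L)).
Qed.

End Layers.

(** * Edge counts in forests *)

Section Forests.
Variables (V : finType).
Implicit Types (S : {set V}) (x y z v w : V).

(** For a symmetric relation each edge inside [S] is counted twice. *)
Definition edge_ends (r : rel V) S := \sum_(v in S) \sum_(w in S) r v w.

Section OneForest.
Variable r : rel V.
Hypothesis r_sym : symmetric r.
Hypothesis r_irr : irreflexive r.
Hypothesis acyclic : forall s : seq V, uniq s -> 2 < size s -> ~~ cycle r s.

(** Without a leaf, a path in [S] could be prolonged for ever: the next vertex differs from the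
    previous one, and returning to an older one would close a cycle. *)
Lemma forest_leaf S : S != set0 -> exists2 v, v \in S & \sum_(w in S) r v w <= 1.
Proof.
case/set0Pn => v0 v0S; apply/exists_inP; apply: contraT => /exists_inPn no_leaf.
(* The path is stored backwards: [x] is its current end and the head of [p] the predecessor of
   [x]. *)
have long n : exists x p, [/\ uniq (x :: p), path r x p, all [in S] (x :: p) & size p = n].
  elim: n => [|n [x [p [uniq_p path_p pS size_p]]]].
    by exists v0, [::]; rewrite /= v0S.
  have xS : x \in S by case/andP: pS.
  have [z zS /andP[xz z_head]] : exists2 z, z \in S & r x z && (ohead p != Some z).
    apply/exists_inP; apply: contraNT (no_leaf x xS) => /exists_inPn none.
    apply: leq_trans (_ : \sum_(w in S) (ohead p == Some w) <= 1).
      apply: leq_sum => w wS; have := none w wS.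
      by rewrite negb_and negbK; case: (r x w) => //= ->.
    case: p {uniq_p path_p pS size_p none} => [|y p] /=.
      by rewrite big1.
    rewrite (bigID (pred1 y)) /= [X in _ + X]big1 => [|w /andP[_ wy]].
      rewrite addn0 big_mkcondl /= big_pred1_eq.
      by case: (y \in S) => //; case: (_ == _).
    by rewrite (inj_eq Some_inj) eq_sym (negPf wy).
  have zx : r z x by rewrite r_sym.
  have zNx : z != x by apply: contraTneq xz => ->; rewrite r_irr.
  have zNp : z \notin p.
    apply/negP => zp; case/splitPr: zp => p1 p2 in uniq_p path_p z_head *.
    move: path_p; rewrite cat_path /= => /and3P[path1 last1 _].
    case: p1 => [|y p1] in uniq_p z_head path1 last1 *; first by rewrite eqxx in z_head.
    have cyc : cycle r (x :: rcons (y :: p1) z).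
      by rewrite /cycle rcons_path last_rcons zx andbT rcons_path path1 last1.
    have uq : uniq (x :: rcons (y :: p1) z).
      by move: uniq_p; rewrite -cat_rcons -cat_cons cat_uniq => /andP[].
    by have := acyclic uq; rewrite cyc /= size_rcons => /(_ isT).
  exists z, (x :: p); split; rewrite /= ?size_p ?zx ?zS //.
  by rewrite inE negb_or zNx zNp.
have [x [p [uniq_p _ _ size_p]]] := long #|V|.
by have := max_card (mem (x :: p)); rewrite (card_uniqP uniq_p) /= size_p ltnn.
Qed.

Lemma forest_edge_ends S : edge_ends r S <= 2 * #|S|.
Proof.
have [n] := ubnP #|S|; elim: n S => // n IHn S lt_n.
have [->|S0] := eqVneq S set0; first by rewrite /edge_ends big1 // => v; rewrite inE.
have [v vS leaf] := forest_leaf S0.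
rewrite /edge_ends (big_setD1 v vS) /=.
have -> : \sum_(w in S :\ v) \sum_(y in S) r w y =
    \sum_(w in S :\ v) r w v + edge_ends r (S :\ v).
  by rewrite /edge_ends -big_split /=; apply: eq_bigr => w _; rewrite (big_setD1 v vS).
have sum_v : \sum_(w in S :\ v) r w v <= \sum_(w in S) r v w.
  by rewrite [leqRHS](big_setD1 v vS) r_irr; apply: eq_leq; apply: eq_bigr => w _; rewrite r_sym.
have cardS := cardsD1 v S; rewrite vS in cardS.
have := IHn (S :\ v); lia.
Qed.

End OneForest.

Lemma arboricity_edge_ends (e : rel V) a S : simple_graph e -> forest_decomp e a ->
  edge_ends e S <= 2 * a * #|S|.
Proof.
move=> [e_sym e_irr] [lab [labC [lab_lt acyclic]]].
have -> : edge_ends e S = \sum_(i < a) edge_ends (fun u v => e u v && (lab u v == i)) S.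
  rewrite exchange_big; apply: eq_bigr => v _; rewrite exchange_big.
  apply: eq_bigr => w _; case: (boolP (e v w)) => /= vw; last by rewrite big1.
  rewrite (bigD1 (Ordinal (lab_lt v w vw))) //= eqxx big1 // => i.
  by rewrite -val_eqE eq_sym => /negPf /= ->.
apply: (@leq_trans (\sum_(i < a) 2 * #|S|)); last by rewrite sum_nat_const card_ord; lia.
apply: leq_sum => i _; apply: forest_edge_ends => [u v|u|s]; last exact: acyclic.
  by rewrite e_sym; case: (boolP (e v u)) => //= vu; rewrite labC // e_sym.
by rewrite e_irr.
Qed.

End Forests.

(** Each survivor has more than [d] live neighbours, while the live vertices span at most [a]
    forests. *)
Lemma alive_decay N (G : instance N) d a k : simple_graph (@adj N G) ->
  forest_decomp (@adj N G) a ->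
  d.+1 * #|[set v : G | alive d k.+1 v]| <= 2 * a * #|[set v : G | alive d k v]|.
Proof.
move=> simple_G forests; apply: leq_trans (arboricity_edge_ends _ simple_G forests).
rewrite mulnC -sum_nat_const.
apply: (@leq_trans (\sum_(v in [set v : G | alive d k.+1 v]) cnt v (alive d k))).
  by apply: leq_sum => v; rewrite inE /= => /andP[].
rewrite /edge_ends big_mkcond [leqRHS]big_mkcond /=; apply: leq_sum => v _.
rewrite !inE /=; case: (alive d k v) => //=; case: ltnP => // _.
rewrite /cnt big_mkcond [leqRHS]big_mkcond; apply: leq_sum => w _ /=.
by rewrite inE; case: (adj v w); case: (alive d k w).
Qed.

(** * The colouring *)

Section Scheme.
Variables (N L d0 Delta rD rA h0 : nat).

(** The minimum with [Delta] ensures [rA <= rD], which the palettes inside layers rely on. In [M],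
    there are [2 * rA + 3] letters of [sep], each with [8] path colours. *)
Let d := minn d0 Delta.
Let K := rD + rA + 3.
Let M := (2 * rA + 3) * 8.
Let B := 2 * M + 2.

Let M_gt0 : 0 < M. Proof. by rewrite /M; lia. Qed.
Let B_geq : 2 * M + 2 <= B. Proof. exact: leqnn. Qed.

Let modn_lt_M m u : 0 < m -> m <= rA.+2 -> u %% m < M.
Proof. by move=> m_gt0 le_m; apply: leq_trans (ltn_pmod _ m_gt0) _; rewrite /M; lia. Qed.

Definition own_bound j := (d %/ rA.+1 ^ j).+2.
(** The maximum keeps this above [own_bound], as [level_total] starts from a bound on the owned
    edges. *)
Definition total_bound j := (maxn (Delta %/ rD.+1 ^ j) (d %/ rA.+1 ^ j)).+2.

Definition cv_rounds := (cv_bits h0).+1.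

Definition grouped_col m T (G : instance N) (cls : G -> G -> nat) :=
  let lay := @layer N d0 L G in
  level_col L M K T lay cls (label_of lay cls m) (group_of lay cls m).

Fixpoint prefix j (G : instance N) (u v : G) : nat :=
  if j is j'.+1
  then prefix j' u v * K + grouped_col rA.+1 (total_bound j) (@prefix j' G) u v
  else 0.

(** An auxiliary level that is no letter of the colour: it asks for no smaller classes, and groups
    of size [rA.+2] comprise all owned edges of a class with one direction. *)
Definition sep j (G : instance N) := @grouped_col rA.+2 (total_bound j) G (@prefix j G).

Definition slots j (G : instance N) :=
  schedule (@layer N d0 L G) (@prefix j G) (@sep j G) cv_rounds.

(** Threshold [1] and a single group: within a class, no letter may be repeated at a vertex. *)
Definition last_col j (G : instance N) :=
  let lay := @layer N d0 L G in
  level_col L M K 1 lay (@prefix j G) (final_label M lay (@prefix j G) (@slots j G))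
    (fun _ _ => 0).

Definition colour j (G : instance N) (u v : G) : nat :=
  prefix j u v * K + last_col j u v.

(** The layers, [j] levels with one round each for ranks, then [sep], the colour reduction and the
    last level; [B * L.+1] covers the greatest depth. *)
Definition radius j := L + j * B.+1 + B.+2 + cv_rounds + B + B * L.+1.

Lemma prefix_local j : elocal L (@layer N d0 L) (L + j * B.+1) B (@prefix j).
Proof.
elim: j => [|j IHj] G G' u v u' v' uv uv' su sv //=.
have lay_local : vlocal (L + j * B.+1) (@layer N d0 L).
  by move=> H H' w w' sw; apply: layer_local; apply: sim_leq sw; lia.
have le_j : L + j * B.+1 + B * depth L (@layer N d0 L G) u v <=
    L + j.+1 * B.+1 + B * depth L (@layer N d0 L G) u v by lia.
congr (_ * _ + _); first by apply: IHj => //; apply: sim_leq le_j _.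
have lay_local1 : vlocal (L + j * B.+1).+1 (@layer N d0 L).
  by move=> H H' w w' sw; apply: layer_local; apply: sim_leq sw; lia.
have := @level_col_local N L (@layer N d0 L) (L + j * B.+1).+1 lay_local1 M K
  (total_bound j.+1) B (@prefix j) (fun G => label_of (@layer N d0 L G) (@prefix j G) rA.+1)
  (fun G => group_of (@layer N d0 L G) (@prefix j G) rA.+1).
have -> : (L + j * B.+1).+1 + B = L + j.+1 * B.+1 by lia.
move=> H; apply: H uv uv' su sv => //.
- by move=> H w y; apply: modn_lt_M.
- by apply: (elocal_leq (leqnSn _) IHj).
- exact: label_local.
exact: group_local.
Qed.

Lemma colour_local j (G G' : instance N) (u v : G) (u' v' : G') :
  adj u v -> adj u' v' -> sim (radius j) u u' -> sim (radius j) v v' ->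
  colour j u v = colour j u' v'.
Proof.
move=> uv uv' su sv; set r := L + j * B.+1.
have lay_local s : vlocal (r + s) (@layer N d0 L).
  by move=> H H' w w' sw; apply: layer_local; apply: sim_leq sw; rewrite /r; lia.
have prefix_loc s : elocal L (@layer N d0 L) (r + s) B (@prefix j).
  by move=> H H'; refine (elocal_leq (leq_addr _ _) (@prefix_local j) (G:=H) (G':=H')).
have sep_loc : elocal L (@layer N d0 L) (r + B.+1) B (@sep j).
  have := @level_col_local N L (@layer N d0 L) (r + 1) (lay_local 1) M K
    (total_bound j) B (@prefix j) (fun G => label_of (@layer N d0 L G) (@prefix j G) rA.+2)
    (fun G => group_of (@layer N d0 L G) (@prefix j G) rA.+2).
  rewrite -addnA add1n; apply => //.
  - by move=> H w y; apply: modn_lt_M.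
  - have := @label_local N L (@layer N d0 L) r B (@prefix j); rewrite addn1; apply.
      by have := lay_local 0; rewrite addn0.
    by have := prefix_loc 0; rewrite addn0.
  have := @group_local N L (@layer N d0 L) r B (@prefix j); rewrite addn1; apply.
    by have := lay_local 0; rewrite addn0.
  by have := prefix_loc 0; rewrite addn0.
have slots_loc := @schedule_local N L (@layer N d0 L) (r + B.+1) B (@prefix j) (@sep j)
  (lay_local _) (prefix_loc _) sep_loc cv_rounds.
set r2 := r + (B.+2 + cv_rounds).
have label_loc : elocal L (@layer N d0 L) r2 B (fun G =>
    final_label M (@layer N d0 L G) (@prefix j G) (@slots j G)).
  move=> H H' w y w' y' wy wy' sw sy; rewrite /final_label.
  have le_r2 : r + (B.+2 + cv_rounds) <= r2 + B * depth L (@layer N d0 L H) w y.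
    by rewrite leq_addr.
  have iE := inl_sim (lay_local _) (sim_leq le_r2 sw) (sim_leq le_r2 sy).
  rewrite iE; congr modn; case: ifP => _.
    by apply: slots_loc => //; [apply: sim_leq sw | apply: sim_leq sy];
      rewrite leq_add2r /r2; lia.
  have prefix_loc0 := prefix_loc (B.+1 + cv_rounds).
  apply: (@rank_local N L (@layer N d0 L) _ B (@prefix j) (lay_local _) prefix_loc0
    _ _ _ _ _ _ wy wy'); [apply: sim_leq sw | apply: sim_leq sy]; rewrite /r2; lia.
have := @level_col_local N L (@layer N d0 L) r2 (lay_local _) M K 1 B (@prefix j)
  (fun G => final_label M (@layer N d0 L G) (@prefix j G) (@slots j G)) (fun _ _ _ => 0).
have le_depth : depth L (@layer N d0 L G) u v <= L.+1.
  by rewrite /depth; case: ifP => // _; lia.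
have le_rad : r2 + B + B * depth L (@layer N d0 L G) u v <= radius j.
  by rewrite /radius -/r /r2; have := leq_mul (leqnn B) le_depth; lia.
move=> last_loc; rewrite /colour; congr (_ * _ + _).
  by apply: (prefix_loc (B.+2 + cv_rounds + B)) => //; [apply: sim_leq su | apply: sim_leq sv];
    rewrite /r2 in le_rad; lia.
have lab_lt (H : instance N) (w y : H) :
    final_label M (@layer N d0 L H) (@prefix j H) (@slots j H) w y < M by rewrite ltn_mod.
exact: (last_loc M_gt0 lab_lt B_geq (prefix_loc _) label_loc (fun _ _ _ _ _ _ _ _ _ _ => erefl)
  _ _ _ _ _ _ uv uv' (sim_leq le_rad su) (sim_leq le_rad sv)).
Qed.

(** * Correctness of the colouring *)

Section Correctness.
Variables (G : instance N) (j0 : nat).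
Hypothesis h0_gt0 : 0 < h0.
Hypothesis leN : N <= 2 ^ h0.
Hypothesis le_rA_rD : rA <= rD.
Hypothesis root_d : d < rA.+1 ^ j0.+1.
Hypothesis root_Delta : Delta < rD.+1 ^ j0.+1.
Hypothesis dead : forall v : G, ~~ alive d0 L v.
Hypothesis max_deg : forall v : G, cnt v predT <= Delta.

Local Notation lay := (@layer N d0 L G).
Local Notation pre j := (@prefix j G).
Local Notation own := (own lay).

Lemma leq_rA2_M : rA.+2 <= M. Proof. by rewrite /M; lia. Qed.

(** Both quotients shrink by at least the stated roots, and [rA <= rD], so at most [rD] letters can
    be exhausted at a head. *)
Lemma total_bound_divn j : (total_bound j).-1 %/ total_bound j.+1 <= rD.
Proof.
rewrite -ltnS ltn_divLR // /total_bound /=.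
have divS a b : a %/ b.+1 ^ j.+1 = a %/ b.+1 ^ j %/ b.+1 by rewrite expnSr divnMA.
rewrite !divS; set y := Delta %/ _; set z := d %/ _.
have := ltn_ceil y (ltn0Sn rD); have := ltn_ceil z (ltn0Sn rA).
set y' := y %/ _; set z' := z %/ _ => ltz lty.
have le1 : y' <= maxn y' z' by rewrite leq_maxl.
have le2 : z' <= maxn y' z' by rewrite leq_maxr.
have : maxn y z < (maxn y' z').+1 * rD.+1.
  rewrite gtn_max (leq_trans lty) ?(leq_trans ltz) //.
    by rewrite leq_mul // ltnS.
  by rewrite leq_mul // ltnS.
by move=> lt_m; apply: leq_ltn_trans lt_m _; rewrite mulnC ltn_pmul2l.
Qed.

Lemma own_total_bound j : own_bound j <= total_bound j.
Proof. by rewrite /own_bound /total_bound !ltnS leq_maxr. Qed.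

Definition bounded j := (forall v k, cnt v (fun y => own v y && (pre j v y == k)) <= own_bound j)
  /\ (forall v k, cnt v (fun y => pre j v y == k) <= total_bound j)
  /\ (forall u v, adj u v -> pre j u v < K ^ j).

Lemma prefixC j u v : pre j u v = pre j v u.
Proof. by elim: j => //= j ->; rewrite /grouped_col level_colC. Qed.

Lemma label_lt m u v (cls : G -> G -> nat) : 0 < m -> m <= M -> label_of lay cls m u v < M.
Proof. by move=> m_gt0; apply: leq_trans; rewrite ltn_mod. Qed.

Section Grouped.
Variables (m T j : nat).
Hypothesis bound_j : bounded j.
Hypothesis m_gt0 : 0 < m.
Hypothesis m_leq : m <= rA.+2.
Hypothesis T_gt0 : 0 < T.
Hypothesis palette : (total_bound j).-1 %/ T + m.-1 < K.

Let le_mM : m <= M := leq_trans m_leq leq_rA2_M.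

Let palette_inl : 2 * m.-1 < K.
Proof. by rewrite /K; lia. Qed.

Lemma grouped_proper v y w : adj v y -> adj v w -> own v y -> own v w ->
  pre j v y = pre j v w -> group_of lay (pre j) m v y = group_of lay (pre j) m v w ->
  y != w -> grouped_col m T (pre j) v y != grouped_col m T (pre j) v w.
Proof.
have [_ [tot _]] := bound_j.
apply: (level_col_proper m_gt0 T_gt0 _ _ tot palette_inl palette).
  by move=> *; apply: group_leq.
move=> v1 y1 w1 vy vw oy ow ec eg es yw.
exact: (group_sched m_gt0 le_mM vy vw oy ow ec eg es yw).
Qed.

Lemma grouped_lt u v : adj u v -> grouped_col m T (pre j) u v < K.
Proof.
have [_ [tot _]] := bound_j.
apply: (level_col_lt _ _ _ m_gt0 T_gt0 _ tot palette_inl palette) => *.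
exact: group_leq.
Qed.

Lemma grouped_inl u v : adj u v -> inl lay u v -> grouped_col m T (pre j) u v <= 2 * m.-1.
Proof.
have [_ [tot _]] := bound_j.
apply: (level_col_inl _ _ _ m_gt0 T_gt0 _ tot palette_inl palette) => *.
exact: group_leq.
Qed.

Lemma grouped_total v k c :
  cnt v (fun y => [&& own v y, pre j v y == k & grouped_col m T (pre j) v y == c]) <= T ->
  cnt v (fun y => (pre j v y == k) && (grouped_col m T (pre j) v y == c)) <= T.
Proof.
have [_ [tot _]] := bound_j.
apply: (level_total m_gt0 T_gt0 _ _ _ tot palette_inl palette) => *.
- exact: layer_leq.
- exact: label_lt.
exact: group_leq.
Qed.

End Grouped.

Lemma own_leq_min v : cnt v (own v) <= d.
Proof.
rewrite leq_min own_layer_leq //; apply: leq_trans (max_deg v).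
exact: cnt_leq.
Qed.

Lemma digit_split a c k : c < K -> (a * K + c == k) = (a == k %/ K) && (c == k %% K).
Proof.
move=> lt_c; have K_gt0 : 0 < K by rewrite /K; lia.
apply/eqP/andP => [<-|[/eqP-> /eqP->]]; last by rewrite -divn_eq.
by rewrite divnMDl // modnMDl divn_small ?modn_small // addn0.
Qed.

(** The invariant of the levels: [group_count] shrinks the owned part of a class, and [level_total]
    carries the rest along. *)
Lemma bounded_prefix j : bounded j.
Proof.
elim: j => [|j IHj].
  split=> [v k|]; last split=> // v k.
    apply: leq_trans (_ : d <= _); last by rewrite /own_bound expn0 divn1; lia.
    by apply: leq_trans (own_leq_min v); apply: cnt_leq => y _ /andP[].
  apply: leq_trans (_ : Delta <= _).
    by apply: leq_trans (max_deg v); apply: cnt_leq.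
  by rewrite /total_bound expn0 divn1; have := leq_maxl Delta (d %/ 1); lia.
have [own_j [tot_j lt_j]] := IHj.
have palette : (total_bound j).-1 %/ total_bound j.+1 + rA.+1.-1 < K.
  by have := total_bound_divn j; rewrite /K /=; lia.
have T_gt0 : 0 < total_bound j.+1 by [].
have colK u v : adj u v -> grouped_col rA.+1 (total_bound j.+1) (pre j) u v < K.
  exact: (grouped_lt IHj).
have own_S v k c : cnt v (fun y => [&& own v y, pre j v y == k &
    grouped_col rA.+1 (total_bound j.+1) (pre j) v y == c]) <= own_bound j.+1.
  rewrite /own_bound expnSr divnMA; apply: (@group_count _ _ _ _ _ (ltn0Sn rA)) => //.
  by move=> y w; apply: (grouped_proper IHj).
split=> [v k|]; last split=> [v k|u v uv] /=.
- apply: leq_trans (own_S v (k %/ K) (k %% K)); apply: cnt_leq => y vy /=.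
  by rewrite digit_split // colK.
- apply: leq_trans (_ : cnt v (fun y => (pre j v y == k %/ K) &&
      (grouped_col rA.+1 (total_bound j.+1) (pre j) v y == k %% K)) <= _).
    by apply: cnt_leq => y vy /=; rewrite digit_split // colK.
  apply: (grouped_total IHj) => //.
  exact: leq_trans (own_S _ _ _) (own_total_bound j.+1).
have := lt_j u v uv; have := colK u v uv; rewrite expnSr; nia.
Qed.

Lemma own_bound_last : own_bound j0 <= rA.+2.
Proof. by rewrite /own_bound !ltnS -ltnS ltn_divLR ?expn_gt0 // mulnC -expnSr. Qed.

Lemma total_bound_last : total_bound j0 <= rD.+2.
Proof.
rewrite /total_bound !ltnS geq_max -!(ltnS _ rD) !ltn_divLR ?expn_gt0 //.
rewrite -expnS root_Delta; apply: leq_trans (leq_trans root_d _) _; first exact: leqnn.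
by rewrite expnS leq_mul.
Qed.

Lemma sep_palette : (total_bound j0).-1 %/ total_bound j0 + rA.+2.-1 < K.
Proof. by rewrite divn_small // /K /=; lia. Qed.

Lemma inl_own v y : inl lay v y -> own v y.
Proof. by rewrite /own /inl => /eqP->. Qed.

(** After [j0] letters a vertex owns at most [rA.+2] edges of a class, so all ranks fall into the
    first group of their direction. *)
Lemma sep_proper v y w : adj v y -> adj v w -> inl lay v y -> inl lay v w ->
  pre j0 v y = pre j0 v w -> sep j0 v y = sep j0 v w -> y != w ->
  outgoing lay v y != outgoing lay v w.
Proof.
move=> vy vw iy iw ec es yw; have [own_j _] := bounded_prefix j0.
have group0 z : adj v z -> inl lay v z -> group_of lay (pre j0) rA.+2 v z = outgoing lay v z.
  move=> vz iz; rewrite /group_of divn_small ?muln0 ?addn0 //.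
  apply: leq_trans own_bound_last; apply: leq_trans (own_j v (pre j0 v z)).
  apply: leq_trans (rank_lt _ vz (inl_own iz)) _; apply: cnt_leq => t _.
  by move=> /and3P[-> _ ->].
have := @grouped_proper rA.+2 (total_bound j0) j0 (bounded_prefix j0) isT (leqnn _) isT
  sep_palette v y w vy vw (inl_own iy) (inl_own iw) ec.
rewrite !group0 // -/(sep j0 v y) -/(sep j0 v w) es eqxx.
by move=> H; apply/eqP => /(congr1 nat_of_bool) /H /(_ yw).
Qed.

Lemma sepC u v : @sep j0 G u v = sep j0 v u.
Proof. exact: level_colC. Qed.

Lemma cv_rounds_reduced : iter cv_rounds cv_bits h0 <= 3.
Proof. by rewrite /cv_rounds iterSr iter_cv_bits. Qed.

Lemma slots_lt u v : adj u v -> inl lay u v -> slots j0 u v < M.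
Proof.
move=> uv iuv; apply: (schedule_lt sepC sep_proper h0_gt0 leN cv_rounds_reduced uv iuv).
have := grouped_inl (bounded_prefix j0) (isT : 0 < rA.+2) (leqnn _) (isT : 0 < total_bound j0)
  sep_palette uv iuv.
by rewrite -/(sep j0 u v) /=; lia.
Qed.

Lemma slots_proper v y w : adj v y -> adj v w -> inl lay v y -> inl lay v w ->
  pre j0 v y = pre j0 v w -> y != w -> slots j0 v y != slots j0 v w.
Proof.
exact: (schedule_proper (prefixC j0) sepC sep_proper h0_gt0 leN cv_rounds_reduced).
Qed.

Lemma last_palette_inl : 2 * rA.+2.-1 < K.
Proof. by rewrite /K /=; lia. Qed.

Lemma last_palette_cross : (total_bound j0).-1 %/ 1 + rA.+2.-1 < K.
Proof. by have := total_bound_last; rewrite divn1 /K; lia. Qed.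

Lemma last_own_leq v k : cnt v (fun y => own v y && (pre j0 v y == k)) <= rA.+2.
Proof. by have [own_j _] := bounded_prefix j0; apply: leq_trans own_bound_last. Qed.

Local Notation last_label := (final_label M lay (pre j0) (@slots j0 G)).

Lemma last_gid_leq v w : adj v w -> own v w ->
  cnt v (fun y => [&& own v y, pre j0 v y == pre j0 v w & 0 == 0]) <= rA.+2.
Proof.
move=> _ _; apply: leq_trans (last_own_leq v (pre j0 v w)).
by apply: cnt_leq => y _; rewrite andbT.
Qed.

Lemma last_col_proper v y w : adj v y -> adj v w -> own v y -> own v w ->
  pre j0 v y = pre j0 v w -> y != w -> last_col j0 v y != last_col j0 v w.
Proof.
have [_ [tot _]] := bounded_prefix j0 => vy vw oy ow ec yw.
apply: (@level_col_proper N L M K 1 G lay (pre j0) last_label (fun _ _ => 0) rA.+2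
  (total_bound j0) isT isT last_gid_leq _ tot last_palette_inl last_palette_cross v y w) => //.
move=> {vy vw oy ow ec yw y w}v y w vy vw oy ow ec _ es.
rewrite (@final_sched N L M G lay (pre j0) rA.+2 (@slots j0 G) v y w) ?eqxx //.
- exact: leq_rA2_M.
- exact: scheduleC.
- exact: slots_lt.
- exact: slots_proper.
exact: last_own_leq.
Qed.

Lemma last_col_lt (u v : G) : adj u v -> @last_col j0 G u v < K.
Proof.
have [_ [tot _]] := bounded_prefix j0.
exact: (@level_col_lt N L M K 1 G lay (pre j0) last_label (fun _ _ => 0) rA.+2
  (total_bound j0) isT isT last_gid_leq tot last_palette_inl last_palette_cross).
Qed.

Lemma colourC u v : @colour j0 G u v = colour j0 v u.
Proof. by rewrite /colour prefixC /last_col level_colC. Qed.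

Lemma colour_lt u v : adj u v -> @colour j0 G u v < K ^ j0.+1.
Proof.
move=> uv; have [_ [_ lt_j]] := bounded_prefix j0.
by have := lt_j u v uv; have := last_col_lt uv; rewrite /colour expnSr; nia.
Qed.

(** By [last_col_proper] at most one owned edge carries a given word; [level_total] with threshold
    [1] extends this to all edges at [v]. *)
Lemma colour_proper v y w : adj v y -> adj v w -> y != w -> @colour j0 G v y != colour j0 v w.
Proof.
move=> vy vw yw; have [_ [tot _]] := bounded_prefix j0.
apply/eqP => /eqP; rewrite /colour digit_split ?last_col_lt //.
have K_gt0 : 0 < K by rewrite /K; lia.
rewrite divnMDl // modnMDl divn_small ?modn_small ?last_col_lt // addn0.
case/andP => /eqP ec /eqP el.
have own1 : cnt v (fun t => [&& own v t, pre j0 v t == pre j0 v w &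
    last_col j0 v t == last_col j0 v w]) <= 1.
  apply: (@cnt_inj _ _ _ _ (fun=> 0)) => // s t vs vt.
  move=> /and3P[os /eqP cs /eqP ls] /and3P[ot /eqP ct /eqP lt] _.
  apply/eqP/negPn/negP => /(last_col_proper vs vt os ot).
  by rewrite cs ct ls lt eqxx => /(_ erefl).
have lab_lt u t : final_label M lay (pre j0) (@slots j0 G) u t < M by rewrite ltn_mod.
have := @level_total N L M K 1 G lay (pre j0) last_label (fun _ _ => 0) rA.+2
  (total_bound j0) isT isT (@layer_leq _ _ _ _) lab_lt last_gid_leq tot
  last_palette_inl last_palette_cross _ _ _ own1.
rewrite leqNgt => /negP; apply.
rewrite cntE; apply: (@leq_trans #|[set y; w]|); first by rewrite cards2 yw.
apply: subset_leq_card; apply/subsetP => t; rewrite !inE.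
by case/orP => /eqP->; rewrite ?vy ?vw -/(last_col j0 v y) -/(last_col j0 v w) ?ec ?el !eqxx.
Qed.

End Correctness.
End Scheme.

(** * Real bounds *)

Lemma leq_INR m n : m <= n -> (INR m <= INR n)%R.
Proof. by move/leP/le_INR. Qed.

Lemma ltn_INR m n : m < n -> (INR m + 1 <= INR n)%R.
Proof. by move/leq_INR; rewrite S_INR. Qed.

Lemma INR_muln m n : INR (m * n) = (INR m * INR n)%R.
Proof. exact: mult_INR. Qed.

Lemma INR_addn m n : INR (m + n) = (INR m + INR n)%R.
Proof. exact: plus_INR. Qed.

Lemma INR_expn m k : INR (m ^ k) = (INR m ^ k)%R.
Proof. by elim: k => // k IHk; rewrite expnS INR_muln IHk. Qed.

Lemma INR_double k : INR (2 * k) = (2 * INR k)%R.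
Proof. by rewrite INR_muln. Qed.

Lemma ex_nat_above y : (0 <= y)%R -> exists k, (y < INR k <= y + 1)%R.
Proof.
move=> y_ge0; have [up_gt up_le] := archimed y.
have [|k Ek] := IZN (up y); first by apply: le_IZR; lra.
by exists k; rewrite INR_IZR_INZ -Ek; lra.
Qed.

Lemma ex_root x y : 0 < x -> exists r, r ^ x <= y < r.+1 ^ x.
Proof.
move=> x_gt0; have ex0 : exists r, r ^ x <= y by exists 0; rewrite exp0n.
have bound r : r ^ x <= y -> r <= y.
  by apply: leq_trans; case: r => // r; rewrite -{1}(expn1 r.+1) leq_pexp2l.
case: (ex_maxnP ex0 bound) => r le_r max_r; exists r; rewrite le_r ltnNge.
by apply/negP => /max_r; rewrite ltnn.
Qed.

Lemma ln_leq y z : (0 < y)%R -> (y <= z)%R -> (ln y <= ln z)%R.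
Proof. by move=> y_gt0 [/(ln_increasing _ _ y_gt0)/Rlt_le //|->]; apply: Rle_refl. Qed.

Lemma nroot_npos y x : (y <= 0)%R -> nroot y x = 0%R.
Proof. by rewrite /nroot => y_le0; case: (Rle_dec y 0). Qed.

Lemma nroot_pos y x : (0 < y)%R -> nroot y x = Rpower y (/ INR x).
Proof. by rewrite /nroot => y_gt0; case: (Rle_dec y 0) => //= ?; lra. Qed.

Lemma nroot_ge0 y x : (0 <= nroot y x)%R.
Proof.
have [/nroot_npos ->|/Rnot_le_lt/nroot_pos ->] := Rle_dec y 0; first exact: Rle_refl.
exact/Rlt_le/exp_pos.
Qed.

Lemma ln_0 : ln 0 = 0%R.
Proof. by rewrite /ln; case: (Rlt_dec 0 0) => // /[dup] /Rlt_irrefl. Qed.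

Lemma leq_nroot r x y : 0 < x -> (INR (r ^ x) <= y)%R -> (INR r <= nroot y x)%R.
Proof.
move=> x_gt0 le_y; case: r le_y => [|r] le_y; first exact: nroot_ge0.
have r_gt0 : (0 < INR r.+1)%R by apply: lt_0_INR; lia.
have rx_gt0 : (0 < INR (r.+1 ^ x))%R by rewrite INR_expn; apply: pow_lt.
rewrite nroot_pos; last lra.
have x_pos : (0 < INR x)%R by apply: lt_0_INR; lia.
have -> : INR r.+1 = Rpower (INR (r.+1 ^ x)) (/ INR x).
  rewrite INR_expn -Rpower_pow // Rpower_mult Rinv_r; last lra.
  by rewrite Rpower_1.
by apply: Rle_Rpower_l; [apply/Rlt_le/Rinv_0_lt_compat | lra].
Qed.

(** From [1 + t <= exp t] at [t = ln y / x]. It is applied to [q * a] to bound [ln q]. *)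
Lemma ln_leq_nroot y x : 0 < x -> (1 <= y)%R ->
  (1 <= nroot y x)%R /\ (ln y <= INR x * nroot y x)%R.
Proof.
move=> x_gt0 y_ge1; rewrite nroot_pos; last lra.
have x_pos : (0 < INR x)%R by apply: lt_0_INR; lia.
have ln_ge0 : (0 <= ln y)%R by rewrite -ln_1; apply: ln_leq; lra.
have := exp_ineq1_le (/ INR x * ln y); rewrite -/(Rpower y (/ INR x)) => H.
have inv_gt0 := Rinv_0_lt_compat _ x_pos.
have : (0 <= / INR x * ln y)%R by nra.
split; first lra.
have -> : (ln y = INR x * (/ INR x * ln y))%R by field; lra.
nra.
Qed.

Lemma sqr_leq_exp2 j : j ^ 2 <= 4 * 2 ^ j.
Proof.
elim: j => // j IHj; rewrite expnS.
case: j IHj => [|[|[|j]]] // IHj.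
apply: leq_trans (_ : 2 * j.+3 ^ 2 <= _); first by rewrite -!mulnn; lia.
by rewrite (mulnCA 4) leq_mul2l.
Qed.

Lemma log_leq (n : nat) : (INR (up_log 2 n) <= 2 * ln (INR n) + 1)%R.
Proof.
case: n => [|[|n]]; rewrite ?up_log0 ?up_log1 /=; try by rewrite ?ln_1; have := ln_lt_2; try lra.
  rewrite ln_0; lra.
have := up_log_gtn (isT : 1 < 2) (isT : 1 < n.+2).
set u := up_log 2 n.+2 => lt_n; have : (INR (2 ^ u.-1) <= INR n.+2)%R.
  exact/leq_INR/ltnW.
rewrite INR_expn; have -> : INR 2 = 2%R by [].
move=> le_n; have pos : (0 < 2 ^ u.-1)%R by apply: pow_lt; lra.
have := ln_leq pos le_n; rewrite ln_pow; last lra.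
have ln2 := ln_lt_2; have u1 := pos_INR u.-1 => le_ln.
have : (INR u <= INR u.-1 + 1)%R by rewrite -S_INR; apply: leq_INR; lia.
by rewrite -/(INR n.+2); nra.
Qed.

(** The number of rounds is logarithmic in [h], and [h] is of order [s * s]; the crude bound
    [j ^ 2 <= 4 * 2 ^ j] already turns this into a multiple of [s]. *)
Lemma cv_rounds_leq c n s : 0 < c -> (1 <= s)%R -> (ln (INR n) <= s * s)%R ->
  (INR (cv_rounds (c * up_log 2 n).+1) <= (6 * INR c + 2) * s)%R.
Proof.
move=> c_gt0 s_ge1 le_s; rewrite /cv_rounds /cv_bits; set h := (c * _).+1; set k := up_log 2 _.
have c_ge1 : (1 <= INR c)%R by apply: (leq_INR c_gt0).
have le_h : (INR (2 * h) <= 8 * INR c * (s * s))%R.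
  rewrite INR_double /h S_INR INR_muln; have := log_leq n; set u := INR (up_log 2 n) => le_u.
  have s2_ge1 : (1 <= s * s)%R by nra.
  have : (INR c * u <= INR c * (2 * (s * s) + 1))%R by apply: Rmult_le_compat_l; lra.
  have : (INR c <= INR c * (s * s))%R by nra.
  lra.
have lt_k : 2 ^ k.-1 < 2 * h by apply: up_log_gtn => //; rewrite /h; lia.
have le1 := Rle_trans _ _ _ (leq_INR (ltnW lt_k)) le_h.
have := leq_INR (sqr_leq_exp2 k.-1); rewrite -mulnn !INR_muln -/(INR 4).
have -> : INR 4 = 4%R by rewrite INR_IZR_INZ.
set j := INR k.-1; set p := INR (2 ^ k.-1) in le1 * => le2.
have j_ge0 : (0 <= j)%R by apply: pos_INR.
have le_j : (j <= 6 * INR c * s)%R.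
  apply: Rnot_lt_le => lt_j.
  have : (6 * INR c * s * (6 * INR c * s) < j * j)%R by apply: Rmult_le_0_lt_compat; nra.
  have : (0 <= (INR c - 1) * INR c * (s * s))%R.
    by apply: Rmult_le_pos; [apply: Rmult_le_pos; lra | nra].
  have : (0 <= INR c * (s * s))%R by apply: Rmult_le_pos; nra.
  nra.
have : (INR k <= j + 1)%R by rewrite /j -S_INR; apply: leq_INR; lia.
by rewrite -/(INR k.+1) S_INR; nra.
Qed.

(** The value at [q = 2 + eps] of [ln q / ln (q / 2)], which decreases in [q]. *)
Definition layer_factor (eps : R) := (ln (2 + eps) / (ln (2 + eps) - ln 2))%R.

Lemma ln_leq_layer_factor eps q : (0 < eps)%R -> (2 + eps <= q)%R ->
  (0 < ln (q / 2))%R /\ (0 < ln q)%R /\ (ln q <= layer_factor eps * ln (q / 2))%R.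
Proof.
move=> eps_gt0 le_q; have ln2 : (0 < ln 2)%R by rewrite -ln_1; apply: ln_increasing; lra.
have lnE : (ln 2 < ln (2 + eps))%R by apply: ln_increasing; lra.
have lnq : (ln (2 + eps) <= ln q)%R by apply: ln_leq; lra.
have -> : ln (q / 2) = (ln q - ln 2)%R.
  by rewrite /Rdiv ln_mult ?ln_Rinv //; lra.
split; first lra; split; first lra.
rewrite /layer_factor; apply: (Rmult_le_reg_r (ln (2 + eps) - ln 2)); first lra.
have -> : (ln (2 + eps) / (ln (2 + eps) - ln 2) * (ln q - ln 2) * (ln (2 + eps) - ln 2)
  = ln (2 + eps) * (ln q - ln 2))%R by field; lra.
nra.
Qed.

Lemma layer_factor_ge1 eps : (0 < eps)%R -> (1 <= layer_factor eps)%R.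
Proof.
move=> eps_gt0; have [] := ln_leq_layer_factor eps_gt0 (Rle_refl _).
move=> pos [_ le]; have lt : (ln ((2 + eps) / 2) < ln (2 + eps))%R by apply: ln_increasing; lra.
by apply: Rnot_lt_le => ?; nra.
Qed.

(** Each round shrinks the live set by the factor [q / 2], so after [L] rounds fewer than one vertex
    remains. *)
Lemma alive_empty N (G : instance N) d a L q : simple_graph (@adj N G) ->
  forest_decomp (@adj N G) a -> 0 < a -> (2 < q)%R -> (q * INR a < INR d.+1)%R ->
  (INR #|G| < (q / 2) ^ L)%R -> forall v : G, ~~ alive d L v.
Proof.
move=> simple_G forests a_gt0 q_gt2 lt_d lt_L v.
have decay k : ((q / 2) ^ k * INR #|[set v : G | alive d k v]| <= INR #|G|)%R.
  elim: k => [|k IHk].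
    by rewrite /= Rmult_1_l; apply/leq_INR/max_card.
  apply: Rle_trans IHk; rewrite /= (Rmult_comm (q / 2)) Rmult_assoc.
  apply: Rmult_le_compat_l; first by apply: pow_le; lra.
  have := leq_INR (alive_decay d k simple_G forests); rewrite !INR_muln.
  have a_ge1 : (1 <= INR a)%R by apply: (leq_INR a_gt0).
  have := pos_INR #|[set v : G | alive d k.+1 v]|.
  set b' := INR #|_|; set b := INR #|_| => b'_ge0; have -> : INR 2 = 2%R by [].
  move=> le_b; apply: (Rmult_le_reg_l (2 * INR a)); first lra.
  nra.
apply/negP => av; have := decay L.
have : (1 <= INR #|[set v : G | alive d L v]|)%R.
  by apply: (@leq_INR 1); rewrite card_gt0; apply/set0Pn; exists v; rewrite inE.
have : (0 < (q / 2) ^ L)%R by apply: pow_lt; lra.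
nra.
Qed.

(** * The algorithm *)

(** The state holds a countdown, the decision function fixed by the parameters, and the view. *)
Definition gather (F : nat -> nat -> nat -> R -> nat -> nat * (view -> nat -> nat)) : LocalAlg :=
  {| State := (nat * (view -> nat -> nat)) * view;
     Msg := view;
     init := fun n Delta a q x own nbrs => (F n Delta a q x, VLeaf own nbrs);
     send := fun st _ => st.2;
     recv := fun st msgs => ((st.1.1.-1, st.1.2), VNode st.2 msgs);
     halted := fun st => st.1.1 == 0;
     out := fun st => st.1.2 st.2 |}.

Lemma run_gather F N (G : instance N) n Delta a q x r (v : G) :
  r <= (F n Delta a q x).1 ->
  run (gather F) (@adj N G) (@ident N G) n Delta a q x r v =
    (((F n Delta a q x).1 - r, (F n Delta a q x).2), view_at r v).
Proof.
elim: r v => [|r IHr] v le_r /=; first by rewrite subn0; case: (F n Delta a q x).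
rewrite IHr ?(ltnW le_r) //= subn_eq0 leqNgt le_r /= subnS; congr (_, VNode _ _).
rewrite /inbox; congr sort; apply: eq_map => u.
by rewrite IHr // ltnW.
Qed.

(** The decision picks the colour in any instance that shows this view; locality makes the pick
    irrelevant. *)
Lemma local_decision N t (col : forall G : instance N, G -> G -> nat) :
  (forall (G G' : instance N) (u v : G) (u' v' : G'), adj u v -> adj u' v' ->
     sim t u u' -> ident v = ident v' -> col G u v = col G' u' v') ->
  exists f : view -> nat -> nat, forall (G : instance N) (u v : G),
    adj u v -> f (view_at t u) (ident v) = col G u v.
Proof.
move=> col_local; pose P w i c := exists (G : instance N) (u v : G),
  [/\ adj u v, view_at t u = w, ident v = i & col G u v = c].
exists (fun w i => epsilon (inhabits 0) (P w i)) => G u v uv.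
have : P (view_at t u) (ident v) (epsilon (inhabits 0) (P (view_at t u) (ident v))).
  by apply: epsilon_spec; exists (col G u v), G, u, v.
case=> G' [u' [v' [uv' eq_u eq_v <-]]].
by apply: col_local.
Qed.

Definition solves (eps C : R) (c n Delta a : nat) (q : R) (x : nat)
    (tf : nat * (view -> nat -> nat)) :=
  forall G : instance (n ^ c), #|G| = n -> Delta = max_degree (@adj _ G) ->
    arboricity_is (@adj _ G) a -> (2 + eps <= q)%R -> 1 <= x ->
    (INR tf.1 <= C * nroot (q * INR a) x * (INR x + ln (INR n) / ln q))%R /\
    proper_edge_coloring (@adj _ G) (fun u v => tf.2 (view_at tf.1 u) (ident v))
      ((nroot (INR Delta) x + nroot (q * INR a) x + 3) ^ x)%R.

(** [83 = 32 + 51] absorbs the cost per layer, since [rA] and [1] are at most the root of [q * a];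
    the summand [4] absorbs [x] and the rounding of [L]. *)
Definition round_constant (eps : R) (c : nat) : R :=
  (83 * (layer_factor eps + 4) + (6 * INR c + 2))%R.

Lemma instance_simple N (G : instance N) : simple_graph (@adj N G).
Proof. by split; [apply: adj_sym | apply: adj_irr]. Qed.

Lemma radius_rounds L rA h0 j :
  (radius L rA h0 j).+1 = (32 * rA + 51) * (L + j.+1 + 2) + cv_rounds h0.
Proof. by rewrite /radius; nia. Qed.

Lemma rounds_leq eps c n a q x L rA : (0 < eps)%R -> 0 < c -> 0 < a -> 0 < x ->
  (2 + eps <= q)%R -> (INR (rA ^ x) <= q * INR a)%R ->
  (INR L <= ln (INR n) / ln (q / 2) + 1)%R -> (0 <= ln (INR n))%R ->
  (INR ((32 * rA + 51) * (L + x + 2) + cv_rounds (c * up_log 2 n).+1) <=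
     round_constant eps c * nroot (q * INR a) x * (INR x + ln (INR n) / ln q))%R.
Proof.
move=> eps_gt0 c_gt0 a_gt0 x_gt0 le_q le_rA le_L ln_n.
have a_ge1 : (1 <= INR a)%R by apply: (leq_INR a_gt0).
have x_ge1 : (1 <= INR x)%R by apply: (leq_INR x_gt0).
have qa_geq : (q <= q * INR a)%R by nra.
have qa_ge1 : (1 <= q * INR a)%R by lra.
have [lnq2 [lnq ln_factor]] := ln_leq_layer_factor eps_gt0 le_q.
have factor_ge1 := layer_factor_ge1 eps_gt0.
have le_root := leq_nroot x_gt0 le_rA.
have [] := ln_leq_nroot x_gt0 qa_ge1.
set A := nroot _ x in le_root *; set l := (ln (INR n) / ln q)%R => A_ge1 le_xA.
have l_ge0 : (0 <= l)%R.
  by apply: Rmult_le_pos => //; apply/Rlt_le/Rinv_0_lt_compat.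
have le_lnq : (ln q <= INR x * A)%R by apply: Rle_trans le_xA; apply: ln_leq; lra.
have ln_nE : ln (INR n) = (l * ln q)%R by rewrite /l; field; lra.
have le_layers : (ln (INR n) / ln (q / 2) <= layer_factor eps * l)%R.
  apply: (Rmult_le_reg_r (ln (q / 2))) => //.
  have -> : (ln (INR n) / ln (q / 2) * ln (q / 2) = l * ln q)%R.
    by rewrite -ln_nE; field; lra.
  nra.
set s := (A * (INR x + l))%R; have s_geq : (INR x + l <= s)%R by rewrite /s; nra.
have le_cv : (INR (cv_rounds (c * up_log 2 n).+1) <= (6 * INR c + 2) * s)%R.
  apply: cv_rounds_leq => //; first lra.
  (* [ln n] is [l * ln q], and both factors are at most [s], the second by [ln q <= x * A]. *)
  rewrite ln_nE; apply: Rmult_le_compat; try lra.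
  by rewrite /s; nra.
rewrite INR_addn INR_muln (INR_addn (32 * rA)) (INR_muln 32) (INR_addn _ 2) (INR_addn L) /round_constant.
have -> : ((83 * (layer_factor eps + 4) + (6 * INR c + 2)) * A * (INR x + l) =
  83 * (layer_factor eps + 4) * s + (6 * INR c + 2) * s)%R by rewrite /s; ring.
apply: Rplus_le_compat le_cv.
have -> : INR 32 = 32%R by rewrite INR_IZR_INZ.
have -> : INR 51 = 51%R by rewrite INR_IZR_INZ.
have -> : INR 2 = 2%R by [].
have -> : (83 * (layer_factor eps + 4) * s =
  (83 * A) * ((layer_factor eps + 4) * (INR x + l)))%R by rewrite /s; ring.
have L_ge0 := pos_INR L; have rA_ge0 := pos_INR rA.
apply: Rmult_le_compat; nra.
Qed.

Lemma edgeless (V : finType) (e : rel V) u v : forest_decomp e 0 -> ~~ e u v.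
Proof. by case=> lab [_ [lab_lt _]]; apply/negP => /lab_lt. Qed.

Lemma solvable eps c n Delta a q x : (0 < eps)%R -> 1 <= c ->
  exists tf, solves eps (round_constant eps c) c n Delta a q x tf.
Proof.
move=> eps_gt0 c_gt0.
have [q_ge|q_lt] := Rle_dec (2 + eps) q; last by exists (0, fun _ _ => 0) => G _ _ _ /q_lt.
have [->|x_gt0] := posnP x; first by exists (0, fun _ _ => 0).
have [->|a_gt0] := posnP a.
  exists (0, fun _ _ => 0) => G _ _ [forests _] _ _; rewrite Rmult_0_r; split=> /=.
    by rewrite nroot_npos; lra.
  have none u v := negP (@edgeless _ _ u v forests).
  by split=> [u v /none|]; [|split=> [u v w /none|u v /none]].
have a_ge1 : (1 <= INR a)%R by apply: (leq_INR a_gt0).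
have [lnq2 _] := ln_leq_layer_factor eps_gt0 q_ge.
(* [d0] is the integer part of [q * a]. *)
have [[|d0] []] := @ex_nat_above (q * INR a) ltac:(nra); first by move=> /=; nra.
move=> lt_d0; rewrite S_INR => le_d0.
have ln_n : (0 <= ln (INR n))%R.
  case: n => [|n]; first by rewrite /= ln_0; lra.
  by rewrite -ln_1; apply: ln_leq; [lra | apply: (@leq_INR 1)].
have [L [lt_L le_L]] := @ex_nat_above (ln (INR n) / ln (q / 2))
  (Rmult_le_pos _ _ ln_n (Rlt_le _ _ (Rinv_0_lt_compat _ lnq2))).
have pow_L : (INR n < (q / 2) ^ L)%R.
  have pow_gt0 : (0 < (q / 2) ^ L)%R by apply: pow_lt; lra.
  case: (posnP n) => [->//|n_gt0].
  have n_pos : (0 < INR n)%R by apply: lt_0_INR; lia.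
  apply: ln_lt_inv => //; rewrite ln_pow; last lra.
  have -> : ln (INR n) = (ln (INR n) / ln (q / 2) * ln (q / 2))%R by field; lra.
  exact: Rmult_lt_compat_r.
have [rD /andP[le_rD lt_rD]] := ex_root Delta x_gt0.
have [rA /andP[le_rA lt_rA]] := ex_root (minn d0 Delta) x_gt0.
(* The word of length [x = j.+1] consists of [j] prefix letters and the last one. *)
case: x x_gt0 => // j _ in le_rD lt_rD le_rA lt_rA *.
have le_AD : rA <= rD.
  rewrite -ltnS -(ltn_exp2r _ _ (ltn0Sn j)); apply: leq_ltn_trans le_rA _.
  by apply: leq_ltn_trans lt_rD; rewrite geq_minr.
have le_root : (INR (rA ^ j.+1) <= q * INR a)%R.
  by apply: Rle_trans (leq_INR le_rA) _; have := leq_INR (geq_minl d0 Delta); lra.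
set h0 := (c * up_log 2 n).+1; set N := n ^ c.
have leN : N <= 2 ^ h0.
  apply: leq_trans (_ : 2 ^ (c * up_log 2 n) <= _); last by rewrite leq_exp2l.
  by rewrite mulnC expnM leq_exp2r // up_logP.
(* One round beyond [radius] lets [u] see the view of its neighbour [v], which it recognises by the
   identifier. *)
have col_local (G G' : instance N) (u v : G) (u' v' : G') : adj u v -> adj u' v' ->
    sim (radius L rA h0 j).+1 u u' -> ident v = ident v' ->
    @colour N L d0 Delta rD rA h0 j G u v = colour L d0 Delta rD rA h0 j u' v'.
  move=> uv uv' su eq_v; apply: colour_local => //; first exact: sim_leq su.
  exact: (sim_nbr_ident su).
have [f f_col] := local_decision col_local.
exists ((radius L rA h0 j).+1, f) => G card_G degE [forests _] _ _; split.
  have -> : ((radius L rA h0 j).+1, f).1 = _ := radius_rounds L rA h0 j.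
  exact: rounds_leq.
rewrite -[(_, f).2]/f -[(_, f).1]/(radius L rA h0 j).+1.
have dead : forall v : G, ~~ alive d0 L v.
  apply: (alive_empty (instance_simple G) forests a_gt0 _ lt_d0); first lra.
  by rewrite card_G.
have max_deg (v : G) : cnt v predT <= Delta.
  rewrite degE /max_degree; apply: leq_trans (leq_bigmax v).
  by rewrite cntE; apply: subset_leq_card; apply/subsetP => y; rewrite !inE andbT.
split=> [u v uv|].
  have vu : adj v u by rewrite adj_sym.
  by rewrite (f_col _ _ _ uv) (f_col _ _ _ vu); apply: colourC.
split=> [u v w uv uw vw|u v uv].
  by rewrite !f_col //; apply/eqP/colour_proper => //; apply/eqP.
rewrite f_col //.
have := @colour_lt N L d0 Delta rD rA h0 G j (ltn0Sn _) leN le_AD lt_rA lt_rD dead max_deg u v uv.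
move/ltn_INR/Rle_trans; apply; rewrite INR_expn; apply: pow_incr; split; first exact: pos_INR.
rewrite !INR_addn; have -> : INR 3 = 3%R by rewrite INR_IZR_INZ.
apply: Rplus_le_compat_r; apply: Rplus_le_compat; apply: leq_nroot => //.
exact: leq_INR.
Qed.

Lemma pow_expn m k : Nat.pow m k = m ^ k.
Proof. by elim: k => // k /= ->; rewrite expnS. Qed.

(* The statement of the theorem reads [^] on [nat] as [Nat.pow]. *)
From Stdlib Require Import Reals.

Theorem mainTheorem15 :
  forall (eps : R) (c : nat), (0 < eps)%R -> (1 <= c)%N ->
  exists (A : LocalAlg) (C : R),
  forall (V : finType) (e : rel V) (ids : V -> nat) (Delta a x : nat) (q : R),
    simple_graph e ->
    injective ids ->
    (forall v, (ids v < #|V| ^ c)%N) ->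
    Delta = max_degree e ->
    arboricity_is e a ->
    (2 + eps <= q)%R ->
    (1 <= x)%N ->
    let n := #|V| in
    let ahat := (q * INR a)%R in
    exists r : nat,
      (INR r <= C * nroot ahat x * (INR x + ln (INR n) / ln q))%R /\
      (forall v, halted (run A e ids n Delta a q x r v)) /\
      proper_edge_coloring e
        (fun u v => out (run A e ids n Delta a q x r u) (ids v))
        ((nroot (INR Delta) x + nroot ahat x + 3) ^ x)%R.
Proof.
move=> eps c eps_gt0 c_gt0.
(* One algorithm must serve all graphs, so a solution is chosen for every tuple of parameters and
   looked up by [init]. *)
pose choose n Delta a q x := constructive_indefinite_description _
  (solvable n Delta a q x eps_gt0 c_gt0).
pose F n Delta a q x := proj1_sig (choose n Delta a q x).
exists (gather F), (round_constant eps c).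
move=> V e ids Delta a x q [e_sym e_irr] ids_inj ids_lt degE arb_a q_ge x_gt0 n ahat.
have ids_lt' v : ids v < expn n c by rewrite -pow_expn.
pose G := Instance e_sym e_irr ids_inj ids_lt'.
have [rounds [colC [col_proper col_lt]]] :=
  proj2_sig (choose n Delta a q x) G erefl degE arb_a q_ge x_gt0.
exists (F n Delta a q x).1; split=> //.
have runE v := @run_gather F _ G n Delta a q x _ v (leqnn _).
split=> [v|]; first by rewrite (runE v) /= subnn.
split=> [u v uv|]; first by rewrite (runE u) (runE v); apply: colC.
split=> [u v w uv uw vw|u v uv]; last by rewrite (runE u); apply: col_lt.
by rewrite (runE u); apply: col_proper.
Qed.
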